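(* In the setting described in the context (the extended system $q'=f(q)$ on $\mathbb{R}^3\times\mathbb{S}^1$, its family of periodic orbits $\Lambda=\bigcup_{\varepsilon\in E}\Lambda_\varepsilon$, the section $\Sigma=\{y=0\}$, and the distance function $\delta:E\times\mathbb{S}^1\to\mathbb{R}$), assume that there exist $\tau_1,\tau_2\in\mathbb{S}^1$ such that for every $\varepsilon\in E$ $$\frac{\partial}{\partial\varepsilon}\delta(\varepsilon,\tau_1)<0,\qquad \frac{\partial}{\partial\varepsilon}\delta(\varepsilon,\tau_2)>0 .$$ Then for every $\varepsilon\in E\setminus\{0\}$ there exists $\tau^*(\varepsilon)\in(\tau_1,\tau_2)$ such that $W^u(\Lambda_\varepsilon)$ and $W^s(\Lambda_\varepsilon)$ intersect at a point $q(\varepsilon)\in\Sigma$ with $\pi_{(\varepsilon,s)}q(\varepsilon)=(\varepsilon,\tau^*(\varepsilon))$. Moreover, if in addition $$\frac{\partial^2}{\partial\tau\,\partial\varepsilon}\delta(\varepsilon,\tau)>0\qquad\text{for all }\varepsilon\in E\text{ and }\tau\in(\tau_1,\tau_2),$$ then $q(\varepsilon)$ is uniquely defined (there is exactly one $\tau^*(\varepsilon)\in(\tau_1,\tau_2)$ with $p^u(\varepsilon,\tau^*(\varepsilon))=p^s(\varepsilon,\tau^*(\varepsilon))$, and $q(\varepsilon)$ is this common point), and for every fixed $\varepsilon\in E\setminus\{0\}$ the manifolds $W^u(\Lambda_\varepsilon)$ and $W^s(\Lambda_\varepsilon)$ intersect transversally at $q(\varepsilon)$, transversality being considered in the $(x,y,s)$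 coordinates, i.e. inside the slice of the extended phase space with the parameter $\varepsilon$ fixed.
   Context: Let $\mathbb{S}^1=\mathbb{R}/2\pi\mathbb{Z}$, let $f_0:\mathbb{R}^2\to\mathbb{R}^2$ and $g:\mathbb{R}^2\times\mathbb{R}\times\mathbb{R}\to\mathbb{R}^2$, where $g(x,y,\varepsilon,t)$ is $2\pi$-periodic in $t$ and $g(x,y,0,t)=0$, and consider $(x,y)'=f_\varepsilon(x,y,t)=f_0(x,y)+g(x,y,\varepsilon,t)$. All functions are assumed smooth enough that the maps introduced below (in particular $w^u,w^s,\kappa^u,\kappa^s$ and $\delta$) are $C^2$. Extended system. On $\mathbb{R}^3\times\mathbb{S}^1$ with coordinates $q=(x,y,\varepsilon,s)$ consider $q'=f(q)$ given by $x'=\pi_xf_\varepsilon(x,y,s)$, $y'=\pi_yf_\varepsilon(x,y,s)$, $\varepsilon'=0$, $s'=1$, with flow $\Phi_t$. Here $\pi$ with a subscript denotes projection onto the indicated coordinates. Standing assumptions. $E\subset\mathbb{R}$ is a closed interval around $0$. For $\varepsilon=0$ the planar system has a hyperbolic fixed point with a homoclinic orbit along its stable/unstable manifold. For each $\varepsilon\in E$ there is a $2\pi$-periodic hyperbolic orbit $\gamma_\varepsilon(t)$ (the continuation of the fixed point). Put $\Lambda_\varepsilon=\{(\gamma_\varepsilon(s),\varepsilon,s):s\in\mathbb{S}^1\}$ and $\Lambda=\bigcup_{\varepsilon\in E}\Lambda_\varepsilon$. Let $N\subset\mathbb{R}^3\times\mathbb{S}^1$ be a set containing $\Lambda$ and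 put $W^s_{\rm loc}(\Lambda)=\{q:\Phi_t(q)\in N\ \forall t\ge0\}$, $W^u_{\rm loc}(\Lambda)=\{q:\Phi_t(q)\in N\ \forall t\le0\}$. $W^u(\Lambda)$ and $W^s(\Lambda)$ denote the unstable and stable manifolds of $\Lambda$ (the images of the local ones under the flow $\Phi_t$ for $t\ge0$, respectively $t\le0$), and $W^{\iota}(\Lambda_\varepsilon)$, $\iota\in\{u,s\}$, is the part of $W^\iota(\Lambda)$ with parameter coordinate equal to $\varepsilon$. For $\iota\in\{u,s\}$, $W^\iota_{\rm loc}(\Lambda)$ is parameterized by a function $w^\iota:[-r_\iota,r_\iota]\times E\times\mathbb{S}^1\to\mathbb{R}^3\times\mathbb{S}^1$, $r_\iota>0$, with $\pi_{(\varepsilon,s)}w^\iota(r,\varepsilon,s)=(\varepsilon,s)$. Let $\Sigma=\{y=0\}$. Assume that for every $q\in w^u((0,r_u]\times E\times\mathbb{S}^1)$ the first intersection for $t>0$ of the trajectory $\Phi_t(q)$ with $\Sigma$ exists and is transversal, and for every $q\in w^s((0,r_s]\times E\times\mathbb{S}^1)$ the first intersection for $t<0$ of $\Phi_t(q)$ with $\Sigma$ exists and is transversal. Put $t^u(q)=\inf\{t>0:\Phi_t(q)\in\Sigma\}$, $t^s(q)=\sup\{t<0:\Phi_t(q)\in\Sigma\}$, $\tau^\iota(q)=\pi_sq+t^\iota(q)$ and $P^\iota(q)=\Phi_{t^\iota(q)}(q)\in\Sigma$, so $\pi_sP^\iota(q)=\tau^\iota(q)$. Assume there are functions $\kappa^u,\kappa^s:E\times\mathbb{S}^1\to\mathbb{S}^1$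 solving $\tau^\iota\big(w^\iota(r_\iota,\varepsilon,\kappa^\iota(\varepsilon,\tau))\big)=\tau$ for all $(\varepsilon,\tau)$. Define $$p^\iota(\varepsilon,\tau)=P^\iota\big(w^\iota(r_\iota,\varepsilon,\kappa^\iota(\varepsilon,\tau))\big),\qquad \delta(\varepsilon,\tau)=\pi_xp^u(\varepsilon,\tau)-\pi_xp^s(\varepsilon,\tau).$$ Since for $\varepsilon=0$ the stable and unstable manifolds coincide forming a homoclinic orbit, it is assumed that $\delta(0,\tau)=0$ for all $\tau\in\mathbb{S}^1$. $(\tau_1,\tau_2)$ denotes the open arc of $\mathbb{S}^1$ from $\tau_1$ to $\tau_2$. *)

(* Defs.v *)
From HB Require Import structures.
From mathcomp Require Import all_boot all_order all_algebra.
From mathcomp Require Import generic_quotient ring_quotient complex.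
From mathcomp Require Import all_classical all_reals all_analysis.

Set Implicit Arguments.
Unset Strict Implicit.
Unset Printing Implicit Defensive.

Import Order.TTheory GRing.Theory Num.Theory.
Import numFieldNormedType.Exports.

Local Open Scope classical_set_scope.
Local Open Scope ring_scope.
Local Open Scope quotient_scope.

Definition twopiZ (R : realType) : {pred R} :=
  fun x => `[< exists k : int, x = k%:~R * (2 * pi) >].

Lemma twopiZ_zmod_closed (R : realType) : zmod_closed (@twopiZ R).
Proof.
split=> [|x y /asboolP[k ->] /asboolP[l ->]]; apply/asboolP.
  by exists 0; rewrite mul0r.
by exists (k - l); rewrite rmorphB /= mulrBl.
Qed.

HB.instance Definition _ (R : realType) :=
  GRing.isZmodClosed.Build R (@twopiZ R) (@twopiZ_zmod_closed R).

Definition S1 (R : realType) : zmodType :=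
  Quotient.quot (@twopiZ R : zmodClosed R).

Definition toS1 (R : realType) (t : R) : S1 R := \pi_(S1 R) t.

(* The open arc run through from [a] to [b] in the positive direction; it is
   empty when [a = b]. *)
Definition open_arc (R : realType) (a b : S1 R) : set (S1 R) :=
  [set c | exists l u : R,
     [/\ 0 < u < l, l < 2 * pi, b = a + toS1 l & c = a + toS1 u]].

(* Derivative at [x] of a function whose domain is [A]; it is one-sided at an
   end point of an interval [A]. *)
Definition dwithin (R : realType) (A : set R) (f : R -> R) (x : R) : R :=
  lim ((f y - f x) / (y - x) @[y --> within (A `\ x) (nbhs x)]).

Definition derivable_within (R : realType) (A : set R) (f : R -> R) (x : R) :=
  cvg ((f y - f x) / (y - x) @[y --> within (A `\ x) (nbhs x)]).

Definition dcircle (R : realType) (h : S1 R -> R) (s : S1 R) : R :=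
  derive1 (fun u : R => h (s + toS1 u)) 0.

Definition setcoord (R : realType) n (x : 'rV[R]_n) (i : 'I_n) (u : R) :
    'rV[R]_n :=
  \row_j (if j == i then u else x 0 j).

Definition partial_within (R : realType) n (D : set 'rV[R]_n) (i : 'I_n)
    (F : 'rV[R]_n -> R) (x : 'rV[R]_n) : R :=
  dwithin [set u | D (setcoord x i u)] (fun u => F (setcoord x i u)) (x 0 i).

(* [F] is C^k on the set [D], which is a product of nondegenerate intervals in
   all uses below: the partial derivatives up to order [k] exist (one-sided on
   the boundary) and are continuous on [D]. *)
Fixpoint Ck (R : realType) (k : nat) n (D : set 'rV[R]_n)
    (F : 'rV[R]_n -> R) : Prop :=
  {within D, continuous F} /\
  if k is k'.+1 then
    forall i : 'I_n,
      (forall x, D x ->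
         derivable_within [set u | D (setcoord x i u)]
                          (fun u => F (setcoord x i u)) (x 0 i)) /\
      Ck k' D (partial_within D i F)
  else True.

Definition Ck2 (R : realType) (k : nat) n (D : set 'rV[R]_n)
    (F : 'rV[R]_n -> R * R) : Prop :=
  Ck k D (fun z => (F z).1) /\ Ck k D (fun z => (F z).2).

(* The boxes used below are simply connected, so a circle-valued map is
   C^k there exactly when it has a C^k lift to the real line. *)
Definition CkS1 (R : realType) (k : nat) n (D : set 'rV[R]_n)
    (F : 'rV[R]_n -> S1 R) : Prop :=
  exists G : 'rV[R]_n -> R, Ck k D G /\ forall z, D z -> F z = toS1 (G z).

Definition jacobian2 (R : realType) (F : R * R -> R * R) (z : R * R) :
    'M[R]_2 :=
  \matrix_(i < 2, j < 2)
    let c (p : R * R) := if i == 0 then p.1 else p.2 in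
    if j == 0 then derive1 (fun u : R => c (F (u, z.2))) z.1
    else derive1 (fun u : R => c (F (z.1, u))) z.2.

Definition complex_eigenvalue (R : realType) n (A : 'M[R]_n) (l : R[i]) :=
  eigenvalue (map_mx (fun x : R => (x%:C)%C) A) l.

Definition hyperbolic_equilibrium (R : realType) (F : R * R -> R * R)
    (z : R * R) :=
  F z = 0 /\
  forall l : R[i], complex_eigenvalue (jacobian2 F z) l -> complex.Re l != 0.

Definition hyperbolic_fixpoint (R : realType) (F : R * R -> R * R)
    (z : R * R) :=
  F z = z /\
  forall l : R[i], complex_eigenvalue (jacobian2 F z) l -> `|l| != 1.

Record state (R : realType) :=
  State { pix : R; piy : R; pieps : R; pis : S1 R }.

Inductive side := unst | stab.

(* [E = [Emin, Emax]]; [wloc i r e s] and [kappa i e t] are meaningful only for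
   [r] in [[- rad i, rad i]] and [e] in [E]. *)
Record splitting_data (R : realType) := SplittingData {
  f0 : R * R -> R * R;
  gpert : R * R -> R -> R -> R * R;
  Phi : R -> state R -> state R;
  Emin : R;
  Emax : R;
  z0 : R * R;
  gamma : R -> S1 R -> R * R;
  Nloc : set (state R);
  rad : side -> R;
  wloc : side -> R -> R -> S1 R -> state R;
  kappa : side -> R -> S1 R -> S1 R
}.

Section Splitting.
Variables (R : realType) (d : splitting_data R).

Definition feps (e : R) (z : R * R) (t : R) : R * R := f0 d z + gpert d z e t.

Definition E : set R := `[Emin d, Emax d]%classic.

Definition Irad (i : side) : set R := `[- rad d i, rad d i]%classic.

(* The planar part of the extended vector field; [repr] picks a real
   representative of the angle, which is harmless as [gpert] is periodic. *)
Definition field (q : state R) : R * R :=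
  feps (pieps q) (pix q, piy q) (repr (pis q)).

(* The angle is differentiated through a real lift. *)
Definition solution (c : R -> state R) : Prop :=
  exists theta : R -> R, (forall t, pis (c t) = toS1 (theta t)) /\
  forall t : R,
    [/\ is_derive t 1 (fun u => pix (c u)) (field (c t)).1,
        is_derive t 1 (fun u => piy (c u)) (field (c t)).2,
        is_derive t 1 (fun u => pieps (c u)) 0 &
        is_derive t 1 theta 1].

Definition is_flow : Prop :=
  [/\ forall q, Phi d 0 q = q,
      forall t u q, Phi d (t + u) q = Phi d t (Phi d u q) &
      forall q, solution (fun t => Phi d t q)].

Definition homoclinic (h : R -> R * R) : Prop :=
  [/\ forall t : R, is_derive t 1 (fun u => (h u).1) (f0 d (h t)).1 /\
                    is_derive t 1 (fun u => (h u).2) (f0 d (h t)).2,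
      forall t, h t <> z0 d,
      h t @[t --> +oo] --> z0 d &
      h t @[t --> -oo] --> z0 d].

Definition periodic_orbit (e : R) : Prop :=
  forall t : R,
    is_derive t 1 (fun u => (gamma d e (toS1 u)).1)
      (feps e (gamma d e (toS1 t)) t).1 /\
    is_derive t 1 (fun u => (gamma d e (toS1 u)).2)
      (feps e (gamma d e (toS1 t)) t).2.

Definition period_map (e : R) (z : R * R) : R * R :=
  let q := Phi d (2 * pi) (State z.1 z.2 e 0) in (pix q, piy q).

Definition Lambda_ (e : R) : set (state R) :=
  [set q | exists s, q = State (gamma d e s).1 (gamma d e s).2 e s].

Definition Lambda : set (state R) := \bigcup_(e in E) Lambda_ e.

Definition Wloc (i : side) : set (state R) :=
  match i with
  | unst => [set q | forall t, t <= 0 -> Nloc d (Phi d t q)]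
  | stab => [set q | forall t, 0 <= t -> Nloc d (Phi d t q)]
  end.

Definition side_time (i : side) (t : R) : Prop :=
  match i with unst => 0 <= t | stab => t <= 0 end.

Definition Wman (i : side) : set (state R) :=
  [set q | exists t q0, [/\ side_time i t, Wloc i q0 & q = Phi d t q0]].

Definition Weps (i : side) (e : R) : set (state R) :=
  Wman i `&` [set q | pieps q = e].

Definition Sigma : set (state R) := [set q | piy q = 0].

Definition first_hit_transversal (i : side) (q : state R) : Prop :=
  match i with
  | unst => exists t, [/\ 0 < t, Sigma (Phi d t q),
              forall t', 0 < t' < t -> ~ Sigma (Phi d t' q) &
              (field (Phi d t q)).2 != 0]
  | stab => exists t, [/\ t < 0, Sigma (Phi d t q),
              forall t', t < t' < 0 -> ~ Sigma (Phi d t' q) &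
              (field (Phi d t q)).2 != 0]
  end.

Definition thit (i : side) (q : state R) : R :=
  match i with
  | unst => inf [set t | 0 < t /\ Sigma (Phi d t q)]
  | stab => sup [set t | t < 0 /\ Sigma (Phi d t q)]
  end.

Definition tauhit (i : side) (q : state R) : S1 R := pis q + toS1 (thit i q).

Definition Phit (i : side) (q : state R) : state R := Phi d (thit i q) q.

Definition psec (i : side) (e : R) (t : S1 R) : state R :=
  Phit i (wloc d i (rad d i) e (kappa d i e t)).

Definition delta (e : R) (t : S1 R) : R :=
  pix (psec unst e t) - pix (psec stab e t).

Definition d_eps_delta (e : R) (t : S1 R) : R :=
  dwithin E (fun e' => delta e' t) e.

Definition d_tau_eps_delta (e : R) (t : S1 R) : R :=
  dcircle (d_eps_delta e) t.

(* Slice eps = const, coordinates (x, y, s).  The slice of Wman is parameterized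
   by (r, s) |-> Phi_t (wloc i r e s); its angle is s + t, whence the last
   components of the two partial derivatives. *)
Definition frame_r (i : side) (e t r : R) (s : S1 R) : R * R * R :=
  (dwithin (Irad i) (fun r' => pix (Phi d t (wloc d i r' e s))) r,
   dwithin (Irad i) (fun r' => piy (Phi d t (wloc d i r' e s))) r,
   0).

Definition frame_s (i : side) (e t r : R) (s : S1 R) : R * R * R :=
  (dcircle (fun s' => pix (Phi d t (wloc d i r e s'))) s,
   dcircle (fun s' => piy (Phi d t (wloc d i r e s'))) s,
   1).

(* Since [wloc i] is a regular injective parameterization of the (positively or
   negatively) invariant set [Wloc i], the plane spanned by the frame does not
   depend on the representation of [q]. *)
Definition tangent (i : side) (e : R) (q : state R) : set (R * R * R) :=
  [set v | exists t r s, [/\ side_time i t, Irad i r,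
     q = Phi d t (wloc d i r e s) &
     exists a b : R, v = a *: frame_r i e t r s + b *: frame_s i e t r s]].

Definition transversal_at (e : R) (q : state R) : Prop :=
  forall v : R * R * R, exists v1 v2,
    [/\ tangent unst e q v1, tangent stab e q v2 & v = v1 + v2].

Record splitting_setting : Prop := SplittingSetting {
  g_periodic : forall z e t, gpert d z e (t + 2 * pi) = gpert d z e t;
  g_unperturbed : forall z t, gpert d z 0 t = 0;
  f0_C2 : Ck2 2 setT (fun z : 'rV[R]_2 => f0 d (z 0 0, z 0 1));
  g_C2 : Ck2 2 setT (fun z : 'rV[R]_4 => gpert d (z 0 0, z 0 1) (z 0 2) (z 0 3));
  Phi_flow : is_flow;
  Phi_C2 : Ck2 2 setT (fun z : 'rV[R]_5 =>
    let q := Phi d (z 0 0) (State (z 0 1) (z 0 2) (z 0 3) (toS1 (z 0 4))) in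
    (pix q, piy q));
  E_around_0 : Emin d < 0 < Emax d;

  z0_hyperbolic : hyperbolic_equilibrium (f0 d) (z0 d);
  z0_homoclinic : exists h, homoclinic h;

  gamma_orbit : forall e, E e -> periodic_orbit e;
  gamma_hyperbolic : forall e, E e ->
    hyperbolic_fixpoint (period_map e) (gamma d e 0);
  gamma_0 : forall s, gamma d 0 s = z0 d;
  gamma_continuous : Ck2 0 [set z : 'rV[R]_2 | E (z 0 0)]
    (fun z => gamma d (z 0 0) (toS1 (z 0 1)));

  N_Lambda : Lambda `<=` Nloc d;
  rad_gt0 : forall i, 0 < rad d i;
  wloc_eps_s : forall i r e s, Irad i r -> E e ->
    pieps (wloc d i r e s) = e /\ pis (wloc d i r e s) = s;
  wloc_image : forall i, Wloc i =
    [set q | exists r e s, [/\ Irad i r, E e & q = wloc d i r e s]];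
  wloc_inj : forall i r r' e s, Irad i r -> Irad i r' -> E e ->
    wloc d i r e s = wloc d i r' e s -> r = r';
  wloc_C2 : forall i, Ck2 2 [set z : 'rV[R]_3 | Irad i (z 0 0) /\ E (z 0 1)]
    (fun z => let q := wloc d i (z 0 0) (z 0 1) (toS1 (z 0 2)) in
              (pix q, piy q));
  wloc_regular : forall i r e s, Irad i r -> E e ->
    (dwithin (Irad i) (fun r' => pix (wloc d i r' e s)) r,
     dwithin (Irad i) (fun r' => piy (wloc d i r' e s)) r) <> (0, 0);

  hit_transversal : forall i r e s, 0 < r <= rad d i -> E e ->
    first_hit_transversal i (wloc d i r e s);
  thit_C2 : forall i,
    Ck 2 [set z : 'rV[R]_3 | 0 < z 0 0 <= rad d i /\ E (z 0 1)]
      (fun z => thit i (wloc d i (z 0 0) (z 0 1) (toS1 (z 0 2))));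

  kappa_spec : forall i e t, E e ->
    tauhit i (wloc d i (rad d i) e (kappa d i e t)) = t;
  kappa_C2 : forall i, CkS1 2 [set z : 'rV[R]_2 | E (z 0 0)]
    (fun z => kappa d i (z 0 0) (toS1 (z 0 1)));

  delta_C2 : Ck 2 [set z : 'rV[R]_2 | E (z 0 0)]
    (fun z => delta (z 0 0) (toS1 (z 0 1)));
  delta_0 : forall t, delta 0 t = 0
}.

End Splitting.

(* Main.v *)
Require Import Defs.
From mathcomp Require Import all_boot all_order all_algebra.
From mathcomp Require Import generic_quotient ring_quotient.
From mathcomp Require Import all_classical all_reals all_analysis.
From mathcomp Require Import ring lra.

Set Implicit Arguments.
Unset Strict Implicit.
Unset Printing Implicit Defensive.

Import Order.TTheory GRing.Theory Num.Theory.
Import numFieldNormedType.Exports.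

Local Open Scope classical_set_scope.
Local Open Scope ring_scope.

(* The mean value theorem in eps and delta(0, .) = 0 give
   delta(e, t) = e * d_eps delta(xi, t), so delta(e, .) has opposite signs at
   tau1 and tau2 and vanishes in between; a zero is a common point of the two
   section curves.  Applying the mean value theorem in both variables,
   delta(e, t') - delta(e, t) = e (t' - t) d_tau d_eps delta(xi, eta), which
   yields uniqueness and, by compactness, d_tau delta(e, .) != 0 at the zero; no
   symmetry of second derivatives is needed.
   For transversality, the tangent plane of each manifold at q contains the
   extended vector field (f, 1) and the velocity (p', 0, 1) of the section
   curve tau |-> p(e, tau).  As f_y != 0 at q and the two velocities differ by
   (d_tau delta, 0, 0), these vectors span the whole space. *)

(** * Angles and one-sided derivatives *)

Lemma toS1D (R : realType) (a b : R) : toS1 (a + b) = toS1 a + toS1 b.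
Proof. by rewrite /toS1 [LHS]raddfD. Qed.

Lemma toS1E (R : realType) (a b : R) :
  toS1 a = toS1 b <-> exists k : int, a - b = k%:~R * (2 * pi).
Proof.
rewrite /toS1; split=> [/eqP|H]; last apply/eqP; rewrite -Quotient.idealrBE.
  by move/asboolP.
exact/asboolP.
Qed.

Lemma toS1_repr (R : realType) (s : S1 R) : toS1 (repr s) = s.
Proof. exact: reprK. Qed.

(** The difference is an integer multiple of [2 * pi] of modulus below [2 * pi], so the integer is
    0. *)
Lemma toS1_inj_small (R : realType) (a b : R) :
  `|a - b| < 2 * pi -> toS1 a = toS1 b -> a = b.
Proof.
move=> ab /toS1E[k kE]; apply/eqP; rewrite -subr_eq0 kE.
have pi0 : 0 < 2 * pi :> R by rewrite mulr_gt0 // pi_gt0.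
move: ab; rewrite kE normrM (gtr0_norm pi0) gtr_pMl// -intr_norm ltrz1.
case: k {kE} => [[|n]|n] //=; by rewrite mul0r.
Qed.

(** * Arcs of the circle and their lengths *)

Section Arcs.
Variable R : realType.

Lemma toS1_representative (s : S1 R) : exists2 l : R, 0 <= l < 2 * pi & s = toS1 l.
Proof.
have pi0 : 0 < 2 * pi :> R by rewrite mulr_gt0 // pi_gt0.
pose x := repr s; pose n := Num.floor (x / (2 * pi)).
exists (x - n%:~R * (2 * pi)).
  have /andP[] := floor_itv (x / (2 * pi)); rewrite -/n.
  rewrite ler_pdivlMr// ltr_pdivrMr// intrD mulrDl mul1r => nx xn.
  by apply/andP; split; lra.
rewrite -(toS1_repr s) -/x; apply/toS1E; exists n; rewrite opprB addrCA subrr.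
by rewrite addr0.
Qed.

Lemma arc_length (a b : S1 R) : a != b ->
  exists2 l : R, 0 < l < 2 * pi & b = a + toS1 l.
Proof.
move=> ab; have [l /andP[l0 lpi] lE] := toS1_representative (b - a).
exists l; last by rewrite -lE addrC subrK.
rewrite lpi andbT lt_neqAle l0 andbT eq_sym.
apply: contraNneq ab => l_eq0; move: lE; rewrite l_eq0 /toS1 raddf0 => /eqP.
by rewrite subr_eq0 eq_sym.
Qed.

(** The length quantified in [open_arc] is determined by the two end points, because lengths in []0,
    2 * pi[] are separated by [toS1]; it can thus be fixed once and for all. *)
Lemma open_arcP (a : S1 R) (l : R) c : 0 < l < 2 * pi ->
  open_arc a (a + toS1 l) c <-> exists2 u, 0 < u < l & c = a + toS1 u.
Proof.
move=> /andP[l0 lpi]; split=> [[l' [u [/andP[u0 ul] lpi' /addrI lE ->]]]|[u ul ->]].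
  exists u => //; suff -> : l = l' by rewrite u0.
  apply: toS1_inj_small lE; have := lt_trans u0 ul.
  by move=> l'0; rewrite ltr_norml; apply/andP; split; lra.
by exists l, u.
Qed.
End Arcs.

(** The derivative as a relation covers one-sided and two-sided cases together. Uniqueness of [l] is
    a separate matter: it requires [A] to accumulate at [x]. *)
Definition slope_cvg (R : realType) (A : set R) (f : R -> R) (x l : R) :=
  (f y - f x) / (y - x) @[y --> within (A `\ x) (nbhs x)] --> l.

(** * One-variable calculus inside a set *)

Section OneVariable.
Context {R : realType}.
Implicit Types (A B : set R) (f g : R -> R) (x l : R).

(** Multiplying out the quotient removes the division; the estimate is trivial at [y = x], so that
    point is no longer excluded. *)
Lemma slope_cvgP A f x l : slope_cvg A f x l <->
  forall e, 0 < e -> exists2 r, 0 < r & forall y, A y -> `|y - x| < r ->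
    `|f y - f x - l * (y - x)| <= e * `|y - x|.
Proof.
split=> [/cvgrPdist_le fl e e0|H].
  have := fl e e0; rewrite /within /= => /nbhs_ballP[r /= r0 rf].
  exists r => // y Ay yr; have [->|yx] := eqVneq y x.
    by rewrite !subrr mulr0 subr0 normr0 mulr0.
  have := rf y; rewrite -ball_normE /= distrC => /(_ yr).
  have yx0 : y - x != 0 by rewrite subr_eq0.
  have {1}-> : l = l * (y - x) / (y - x) by rewrite mulfK.
  rewrite -mulrBl normrM normfV distrC ler_pdivrMr ?normr_gt0//.
  by apply; split=> // /eqP; rewrite (negbTE yx).
apply/cvgrPdist_le => e /H[r r0 rf].
apply/nbhs_ballP; exists r => //= y; rewrite -ball_normE /= distrC => yr [Ay /eqP yx].
have yx0 : y - x != 0 by rewrite subr_eq0.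
have {1}-> : l = l * (y - x) / (y - x) by rewrite mulfK.
by rewrite -mulrBl normrM normfV distrC ler_pdivrMr ?normr_gt0//; apply: rf.
Qed.

Lemma derivable_within_slope A f x :
  derivable_within A f x -> slope_cvg A f x (dwithin A f x).
Proof. by []. Qed.

Lemma dwithinE A f x l : ProperFilter (within (A `\ x) (nbhs x)) ->
  slope_cvg A f x l -> dwithin A f x = l.
Proof. by move=> PF fl; apply: cvg_lim. Qed.

Lemma slope_cvg_unique A f x l l' : ProperFilter (within (A `\ x) (nbhs x)) ->
  slope_cvg A f x l -> slope_cvg A f x l' -> l = l'.
Proof. by move=> PF fl fl'; rewrite -(dwithinE PF fl) -(dwithinE PF fl'). Qed.

Lemma slope_cvg_sub A B f x l : B `<=` A -> slope_cvg A f x l ->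
  slope_cvg B f x l.
Proof.
move=> BA /slope_cvgP H; apply/slope_cvgP => e /H[r r0 rf].
by exists r => // y /BA; apply: rf.
Qed.

Lemma eq_slope_cvg A f g x l : A x -> (forall y, A y -> f y = g y) ->
  slope_cvg A f x l -> slope_cvg A g x l.
Proof.
move=> Ax fg /slope_cvgP H; apply/slope_cvgP => e /H[r r0 rf].
by exists r => // y Ay; rewrite -!fg//; apply: rf.
Qed.

Lemma slope_cvg_within A f x l : slope_cvg A f x l ->
  f y @[y --> within A (nbhs x)] --> f x.
Proof.
(* Tolerance 1 gives the Lipschitz bound [(|l| + 1) |y - x|] near [x], whence the radius below. *)
move=> /slope_cvgP/(_ 1 ltr01)[r r0 rf]; apply/cvgrPdist_le => e e0.
have l1 : 0 < `|l| + 1 by rewrite ltr_wpDl.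
apply/nbhs_ballP; exists (Num.min r (e / (`|l| + 1))) => /=.
  by rewrite lt_min r0 divr_gt0.
move=> y; rewrite -ball_normE /= lt_min distrC ltr_pdivlMr// => /andP[yr ye] Ay.
rewrite distrC; apply: le_trans (ltW ye).
have := rf y Ay yr; rewrite mul1r => H.
have -> : f y - f x = (f y - f x - l * (y - x)) + l * (y - x) by rewrite subrK.
apply: (le_trans (ler_normD _ _)).
by rewrite [leRHS]mulrDr mulr1 addrC normrM [`|l| * _]mulrC lerD2l.
Qed.

Lemma slope_cvg_derivable f x l : slope_cvg setT f x l <->
  h^-1 *: ((f \o shift x) (h *: 1) - f x) @[h --> 0^'] --> l.
Proof.
split=> [/slope_cvgP H|/cvgrPdist_le H].
  apply/cvgrPdist_le => e /H[r r0 rf].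
  apply/nbhs_ballP; exists r => //= h; rewrite -ball_normE /= sub0r normrN => hr h0.
  have {1}-> : l = h^-1 *: (l * h) by rewrite /GRing.scale /= mulrCA mulVf ?mulr1.
  rewrite -scalerBr normrZ normfV ler_pdivrMl ?normr_gt0// distrC.
  by have := rf (h + x) I; rewrite addrK /= scaler1 (mulrC `|h|); apply.
apply/slope_cvgP => e /H; rewrite /within /= => /nbhs_ballP[r /= r0 rf].
exists r => // y _ yr; have [->|yx] := eqVneq y x.
  by rewrite !subrr mulr0 subr0 normr0 mulr0.
have yx0 : y - x != 0 by rewrite subr_eq0.
have := rf (y - x); rewrite -ball_normE /= sub0r normrN => /(_ yr yx0).
rewrite /= scaler1 subrK.
have {1}-> : l = (y - x)^-1 * (l * (y - x)) by rewrite mulrCA mulVf ?mulr1.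
by rewrite -mulrBr normrM normfV ler_pdivrMl ?normr_gt0// distrC (mulrC `|_|).
Qed.

Lemma slope_cvg_derive1 f x l : slope_cvg setT f x l -> derive1 f x = l.
Proof.
by rewrite derive1E => /slope_cvg_derivable H; apply: cvg_lim.
Qed.

Lemma is_derive_slope f x l : is_derive x 1 f l <-> slope_cvg setT f x l.
Proof.
split=> [[dx <-]|/slope_cvg_derivable H]; first exact/slope_cvg_derivable.
by apply: DeriveDef; [apply/cvg_ex; exists l|apply: cvg_lim].
Qed.

Lemma slope_cvg_near A f x l : (\forall y \near x, A y) -> slope_cvg A f x l ->
  slope_cvg setT f x l.
Proof.
move=> /nbhs_ballP[s /= s0 sA] /slope_cvgP H; apply/slope_cvgP => e /H[r r0 rf].
exists (Num.min r s); first by rewrite lt_min r0.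
move=> y _; rewrite lt_min => /andP[yr ys]; apply: rf => //.
by apply: sA; rewrite -ball_normE /= distrC.
Qed.

(** The end points are unordered because the mean value theorem is applied on both sides of
    [eps = 0] and to arbitrary pairs of angles. *)
Definition between (a b c : R) := Num.min a b <= c <= Num.max a b.

Lemma betweenC a b c : between a b c = between b a c.
Proof. by rewrite /between minC maxC. Qed.

Lemma between_dist a b c : between a b c -> `|c - a| <= `|b - a|.
Proof.
rewrite /between; case: (leP a b) => ab /andP[h1 h2].
  by rewrite !ger0_norm ?subr_ge0// lerD2r.
by rewrite !ler0_norm ?lerN2 ?lerD2r// subr_le0// ltW.
Qed.

Lemma between_l a b : between a b a.
Proof. by rewrite /between ge_min le_max lexx. Qed.

Lemma between_r a b : between a b b.
Proof. by rewrite betweenC between_l. Qed.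

Definition ordconvex A := forall a b c, A a -> A b -> between a b c -> A c.

Lemma ordconvex_itv a b : ordconvex `[a, b]%classic.
Proof.
move=> x y z /=; rewrite !in_itv /between /= => /andP[ax xb] /andP[ay yb].
rewrite ge_min le_max => /andP[/orP[]h1 /orP[]h2]; apply/andP; split; lra.
Qed.

(** [A] contains the segment from [x] to [y], hence points other than [x] arbitrarily close to it;
    this makes limits within [A] unique. *)
Lemma proper_within (A : set R) x y : ordconvex A -> A x -> A y -> x != y ->
  ProperFilter (within (A `\ x) (nbhs x)).
Proof.
move=> Ac Ax Ay xy; apply: within_nbhs_proper => U /nbhs_ballP[r /= r0 rU].
have yx0 : 0 < `|y - x| by rewrite normr_gt0 subr_eq0 eq_sym.
(* The point [x + m (y - x)] is on the segment since [m <= 1], and at distance at most [r / 2] from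
   [x]. *)
pose m := Num.min 1 (r / 2 / `|y - x|).
have m0 : 0 < m by rewrite lt_min ltr01 !divr_gt0.
have m1 : m <= 1 by rewrite ge_min lexx.
exists (x + m * (y - x)); split; last first.
  apply: rU; rewrite -ball_normE /= opprD addNKr normrN normrM gtr0_norm//.
  have : m <= r / 2 / `|y - x| by rewrite ge_min lexx orbT.
  rewrite ler_pdivlMr// => /le_lt_trans; apply; lra.
split.
  apply: Ac Ax Ay _; rewrite /between.
  by case: (leP x y) => ?; apply/andP; split; nra.
move/eqP; rewrite -[X in _ == X]addr0 (inj_eq (addrI x)) mulf_eq0 gt_eqF//=.
by rewrite subr_eq0 eq_sym (negbTE xy).
Qed.

Lemma proper_setT (x : R) : ProperFilter (within (setT `\ x) (nbhs x)).
Proof.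
apply: (@proper_within _ x (x + 1)) => //.
by rewrite eq_sym -subr_eq0 addrAC subrr add0r oner_eq0.
Qed.

(** Inside []a, b[] the derivative within [A] is two-sided, and at the end points the classical
    theorem asks only for continuity. *)
Lemma mvt_within_lt A f a b : ordconvex A -> A a -> A b -> a < b ->
  (forall x, A x -> derivable_within A f x) ->
  exists2 c, between a b c & f b - f a = dwithin A f c * (b - a).
Proof.
move=> Aconv Aa Ab ab df.
have abA : `[a, b]%classic `<=` A.
  by move=> c /=; rewrite in_itv /= => cab; apply: (Aconv a b) => //;
    rewrite /between min_l ?max_r// ltW.
have dfx x : x \in `]a, b[ -> is_derive x 1 f (dwithin A f x).
  move=> xab; apply/is_derive_slope/(@slope_cvg_near A).
    near=> y; apply: abA; apply: subset_itv_oo_cc => /=.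
    by near: y; apply: near_in_itvoo.
  exact/derivable_within_slope/df/abA/subset_itv_oo_cc.
have fc : {within `[a, b], continuous f}.
  apply/subspace_continuousP => x xab.
  apply: (@slope_cvg_within _ f x (dwithin A f x)).
  by apply: (slope_cvg_sub abA); apply/derivable_within_slope/df/abA.
have [c cab ->] := MVT ab dfx fc.
move: cab; rewrite in_itv/= => /andP[ac cb]; exists c => //.
by rewrite /between min_l ?max_r ?(ltW ab)// (ltW ac) (ltW cb).
Unshelve. all: by end_near. Qed.

Lemma mvt_within A f a b : ordconvex A -> A a -> A b ->
  (forall x, A x -> derivable_within A f x) ->
  exists2 c, between a b c & f b - f a = dwithin A f c * (b - a).
Proof.
move=> Aconv Aa Ab df; have [ab|ba|->] := ltgtP a b.
- exact: mvt_within_lt.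
- have [c cba fE] := mvt_within_lt Aconv Ab Aa ba df.
  by exists c; rewrite 1?betweenC// -opprB fE -mulrN opprB.
- by exists b; rewrite ?subrr ?mulr0//; apply: between_l.
Qed.
End OneVariable.

(** * Total differentiability on boxes *)

Section Multivariate.
Context {R : realType}.

(** Stronger than convexity: the whole coordinate box spanned by two points stays in [D], so
    coordinates can be changed one at a time. *)
Definition box_convex n (D : set 'rV[R]_n) := forall p q z : 'rV[R]_n, D p -> D q ->
  (forall i, between (p 0 i) (q 0 i) (z 0 i)) -> D z.

Definition C1 n (D : set 'rV[R]_n) (F : 'rV[R]_n -> R) := forall i,
  (forall x, D x -> derivable_within [set u | D (setcoord x i u)]
                      (fun u => F (setcoord x i u)) (x 0 i)) /\
  {within D, continuous (partial_within D i F)}.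

Lemma Ck_continuous k n (D : set 'rV[R]_n) F :
  Ck k D F -> {within D, continuous F}.
Proof. by case: k => [|k] []. Qed.

Lemma Ck_C1 k n (D : set 'rV[R]_n) F : Ck k.+1 D F -> C1 D F.
Proof. by move=> [_ H] i; have [dF /Ck_continuous] := H i. Qed.

Lemma setcoordE n (x : 'rV[R]_n) i u j :
  setcoord x i u 0 j = if j == i then u else x 0 j.
Proof. by rewrite mxE. Qed.

Lemma setcoord_setcoord n (x : 'rV[R]_n) i u v :
  setcoord (setcoord x i u) i v = setcoord x i v.
Proof. by apply/rowP => j; rewrite !setcoordE; case: eqP. Qed.

Lemma box_convex_section n (D : set 'rV[R]_n) x i : box_convex D ->
  ordconvex [set u | D (setcoord x i u)].
Proof.
move=> Dc a b c Da Db abc; apply: Dc Da Db _ => j; rewrite !setcoordE.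
by case: eqP => // _; apply: between_l.
Qed.

Lemma mvt_coord n (D : set 'rV[R]_n) F x i a b : box_convex D -> C1 D F ->
  D (setcoord x i a) -> D (setcoord x i b) ->
  exists2 c, between a b c & F (setcoord x i b) - F (setcoord x i a) =
    partial_within D i F (setcoord x i c) * (b - a).
Proof.
move=> Dc F1 Da Db.
have E u : (fun v => F (setcoord (setcoord x i u) i v)) =
    (fun v => F (setcoord x i v)).
  by apply/funext => v; rewrite setcoord_setcoord.
have E' u : [set v | D (setcoord (setcoord x i u) i v)] =
    [set v | D (setcoord x i v)].
  by apply/funext => v /=; rewrite setcoord_setcoord.
have dF u : [set v | D (setcoord x i v)] u ->
    derivable_within [set v | D (setcoord x i v)]
      (fun v => F (setcoord x i v)) u.
  by move=> /(proj1 (F1 i)); rewrite E E' setcoordE eqxx.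
have [c abc fE] := mvt_within (box_convex_section Dc) Da Db dF.
by exists c => //; rewrite /partial_within E E' setcoordE eqxx.
Qed.

Lemma mvt_hybrid n (D : set 'rV[R]_n) F p0 p : box_convex D -> C1 D F ->
  D p0 -> D p ->
  exists z : 'I_n -> 'rV[R]_n,
    (forall i, D (z i) /\ forall j, between (p0 0 j) (p 0 j) (z i 0 j)) /\
    F p - F p0 = \sum_i partial_within D i F (z i) * (p 0 i - p0 0 i).
Proof.
move=> Dc F1 D0 Dp.
(* The path from [p0] to [p] replaces one coordinate per step; [q k] has its first [k] coordinates
   from [p]. *)
pose q k : 'rV[R]_n := \row_j (if (j < k)%N then p 0 j else p0 0 j).
have qE k j : q k 0 j = if (j < k)%N then p 0 j else p0 0 j by rewrite mxE.
have Dq k : D (q k).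
  apply: Dc D0 Dp _ => j; rewrite qE.
  by case: ifP => _; [apply: between_r|apply: between_l].
have qk (k : 'I_n) : setcoord (q k) k (p0 0 k) = q k.
  apply/rowP => j; rewrite setcoordE qE; case: eqP => // ->.
  by rewrite ltnn.
have qSk (k : 'I_n) : setcoord (q k) k (p 0 k) = q k.+1.
  apply/rowP => j; rewrite setcoordE !qE ltnS; case: eqP => [->|/eqP jk].
    by rewrite leqnn.
  by rewrite [in RHS]leq_eqVlt (inj_eq val_inj) (negbTE jk).
have H (k : 'I_n) : exists z, (D z /\ forall j, between (p0 0 j) (p 0 j) (z 0 j)) /\
    F (q k.+1) - F (q k) = partial_within D k F z * (p 0 k - p0 0 k).
  have [||c cb] := @mvt_coord _ D F (q k) k (p0 0 k) (p 0 k) Dc F1.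
  - by rewrite qk.
  - by rewrite qSk.
  rewrite qk qSk => ->; exists (setcoord (q k) k c); split=> //.
  have bt j : between (p0 0 j) (p 0 j) (setcoord (q k) k c 0 j).
    rewrite setcoordE qE; case: eqP => [->//|_].
    by case: ifP => _; [apply: between_r|apply: between_l].
  by split=> //; apply: Dc D0 Dp _.
have [z zP] := choice H.
exists z; split=> [i|]; first exact: (zP i).1.
have -> : p = q n by apply/rowP => j; rewrite qE ltn_ord.
have -> : p0 = q 0%N by apply/rowP => j; rewrite qE.
rewrite -(telescope_sumr (fun k => F (q k))) // big_mkord.
apply: eq_bigr => k _; rewrite (zP k).2; congr (_ * (_ - _)).
  by rewrite qE ltn_ord.
by rewrite qE.
Qed.

(** Differentiability in Caratheodory form: an exact increment formula with coefficients that are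
    continuous at [p0]. They are partial derivatives at the mean value points, which tend to [p0] as
    [p] does. *)
Lemma caratheodory n (D : set 'rV[R]_n) F p0 : box_convex D -> C1 D F ->
  D p0 -> exists A : 'I_n -> 'rV[R]_n -> R,
    (forall p, D p -> F p - F p0 = \sum_i A i p * (p 0 i - p0 0 i)) /\
    forall i, A i p @[p --> within D (nbhs p0)] --> partial_within D i F p0.
Proof.
move=> Dc F1 D0.
have H p : exists z : 'I_n -> 'rV[R]_n, D p ->
    (forall i, D (z i) /\ forall j, between (p0 0 j) (p 0 j) (z i 0 j)) /\
    F p - F p0 = \sum_i partial_within D i F (z i) * (p 0 i - p0 0 i).
  have [/(mvt_hybrid Dc F1 D0)[z zP]|nDp] := pselect (D p); first by exists z.
  (* Outside [D] nothing is claimed, and [p0] is a default value. *)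
  by exists (fun=> p0).
have [z zP] := choice H.
exists (fun i p => partial_within D i F (z p i)); split=> [p /zP[]//|i].
have /subspace_continuousP/(_ _ D0) := (F1 i).2.
apply: cvg_comp => S; rewrite /= !/within /= => /nbhs_ballP[e /= e0 eS].
apply/nbhs_ballP; exists e => //= p pe Dp.
have [/(_ i)[Dz zb] _] := zP _ Dp; apply: eS => //; split=> // a j; rewrite ord1.
have := pe.2 0 j; rewrite -!ball_normE /= => pj.
by rewrite distrC (le_lt_trans (between_dist (zb j)))// distrC.
Qed.

Lemma cvg_curve n (D : set 'rV[R]_n) B (P : R -> 'rV[R]_n) x :
  (forall u, B u -> D (P u)) ->
  (forall i, P u 0 i @[u --> within B (nbhs x)] --> P x 0 i) ->
  P u @[u --> within B (nbhs x)] --> within D (nbhs (P x)).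
Proof.
move=> PD Pc S; rewrite /within /= => /nbhs_ballP[e /= e0 eS].
have : \forall u \near within B (nbhs x), forall i, `|P x 0 i - P u 0 i| < e.
  by apply: filter_forall => i; have /cvgrPdist_lt := Pc i; apply.
rewrite near_withinE; apply: filterS => u H Bu; apply: eS (PD _ Bu).
split=> // a j; by rewrite ord1 -ball_normE /=; apply: H.
Qed.

(** Chain rule along a curve in [D], valid on the boundary too: the Caratheodory formula is divided
    by [u - x]. *)
Lemma slope_cvg_comp n (D : set 'rV[R]_n) F B (P : R -> 'rV[R]_n) x v :
  box_convex D -> C1 D F -> B x -> (forall u, B u -> D (P u)) ->
  (forall i, slope_cvg B (fun u => P u 0 i) x (v i)) ->
  slope_cvg B (fun u => F (P u)) x (\sum_i partial_within D i F (P x) * v i).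
Proof.
move=> Dc F1 Bx PD Pv.
have [A [FE AF]] := caratheodory Dc F1 (PD _ Bx).
have Pc := cvg_curve PD (fun i => slope_cvg_within (Pv i)).
rewrite /slope_cvg.
have : \sum_i A i (P u) * ((P u 0 i - P x 0 i) / (u - x))
   @[u --> within (B `\ x) (nbhs x)] --> \sum_i partial_within D i F (P x) * v i.
  apply: cvg_big => [|i _]; first exact: add_continuous.
  apply: cvgM; last exact: Pv.
  have := cvg_comp _ _ Pc (AF i); apply: cvg_trans; apply: cvg_app.
  by apply: within_subset => y [].
apply: cvg_trans; apply: near_eq_cvg.
rewrite near_withinE; near=> u => -[Bu _].
rewrite FE ?mulr_suml; last exact: PD.
by apply: eq_bigr => i _; rewrite mulrA.
Unshelve. all: by end_near. Qed.
End Multivariate.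

(** * Derivatives along curves on the manifolds *)

Definition pt (R : realType) n (s : seq R) : 'rV[R]_n := \row_(i < n) nth 0 s i.

(** A boolean selects the coordinate, so that each derivative formula is proved once for [x] and
    [y]. *)
Definition coord (R : realType) (b : bool) (q : state R) : R :=
  if b then pix q else piy q.

(** * Elementary slopes *)

Section SlopeArith.
Context {R : realType}.
Implicit Types (A B : set R) (f g : R -> R).

Lemma slope_cvg_cst A (c x : R) : slope_cvg A (fun=> c) x 0.
Proof.
apply/slope_cvgP => e e0; exists 1 => // y _ _.
by rewrite subrr mul0r subr0 normr0 mulr_ge0// ltW.
Qed.

Lemma slope_cvg_id A (x : R) : slope_cvg A id x 1.
Proof.
apply/slope_cvgP => e e0; exists 1 => // y _ _.
by rewrite mul1r subrr normr0 mulr_ge0// ltW.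
Qed.

Lemma slope_cvg_lin A f g (x a l m : R) : slope_cvg A f x l -> slope_cvg A g x m ->
  slope_cvg A (fun u => f u + a * g u) x (l + a * m).
Proof.
move=> fl gm; rewrite /slope_cvg.
have -> : (fun y => (f y + a * g y - (f x + a * g x)) / (y - x)) =
    (fun y => (f y - f x) / (y - x) + a * ((g y - g x) / (y - x))).
  by apply/funext => y; rewrite mulrA -mulrDl; congr (_ / _); ring.
by apply: cvgD => //; apply: cvgM => //; apply: cvg_cst.
Qed.

Lemma slope_cvg_shift A (a x : R) : slope_cvg A (fun u => a + u) x 1.
Proof.
have := slope_cvg_lin (a := 1) (slope_cvg_cst A a x) (slope_cvg_id A x).
by rewrite mulr1 add0r; under eq_fun do rewrite mul1r.
Qed.

Lemma slope_cvg_shift_arg (f : R -> R) x l :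
  slope_cvg setT f x l <-> slope_cvg setT (fun u => f (x + u)) 0 l.
Proof.
split=> /slope_cvgP H; apply/slope_cvgP => e /H[r r0 rf]; exists r => // y _.
  rewrite subr0 addr0 => yr; have := rf (x + y) I.
  by rewrite [x + y - x]addrAC subrr add0r; apply.
move=> yr; have := rf (y - x) I.
by rewrite subr0 addr0 (_ : x + (y - x) = y); [apply|ring].
Qed.

End SlopeArith.

(** * Chain rules for the local manifolds and the flow *)

Section Dynamics.
Variables (R : realType) (d : splitting_data R).
Hypothesis S : splitting_setting d.

Local Notation E := (E d).
Local Notation Irad := (Irad d).

Lemma wloc_C1 b i : C1 [set z : 'rV[R]_3 | Irad i (z 0 0) /\ E (z 0 1)]
  (fun z => coord b (wloc d i (z 0 0) (z 0 1) (toS1 (z 0 2)))).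
Proof. by have [/Ck_C1 H1 /Ck_C1 H2] := wloc_C2 S i; case: b. Qed.

Lemma wloc_box i : box_convex [set z : 'rV[R]_3 | Irad i (z 0 0) /\ E (z 0 1)].
Proof.
by move=> p q z [p1 p2] [q1 q2] pq; split; apply: ordconvex_itv (pq _).
Qed.

(** The coefficients depend on the base point only and are chosen before the curve, so test curves
    can identify them later. The parameter is constant along the curve, which leaves the entries 0
    and 2 of [(r, eps, s)]. *)
Lemma wloc_chain i b r0 e S0 : E e -> exists Wr Ws,
  forall B x r s vr vs, B x -> r x = r0 -> s x = S0 ->
  (forall u, B u -> Irad i (r u)) -> slope_cvg B r x vr -> slope_cvg B s x vs ->
  slope_cvg B (fun u => coord b (wloc d i (r u) e (toS1 (s u)))) x
    (Wr * vr + Ws * vs).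
Proof.
move=> Ee.
pose D := [set z : 'rV[R]_3 | Irad i (z 0 0) /\ E (z 0 1)].
pose F := fun z : 'rV[R]_3 => coord b (wloc d i (z 0 0) (z 0 1) (toS1 (z 0 2))).
pose W k := partial_within D k F (pt 3 [:: r0; e; S0]).
exists (W ord0), (W (lift ord0 (lift ord0 ord0))).
move=> B x r s vr vs Bx rx sx rB dr ds.
pose P u := pt 3 [:: r u; e; s u].
have PD u : B u -> D (P u) by move=> Bu; split; rewrite mxE //=; apply: rB.
have dP (j : 'I_3) : slope_cvg B (fun u => P u 0 j) x (nth 0 [:: vr; 0; vs] j).
  case: j => -[|[|[|//]]] jlt /=; under eq_fun do rewrite mxE /=; 
   [exact: dr|exact: slope_cvg_cst|exact: ds].
have := slope_cvg_comp (@wloc_box i) (@wloc_C1 b i) Bx PD dP.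
rewrite !big_ord_recl big_ord0 /= /P rx sx mulr0 add0r addr0.
by apply: eq_slope_cvg => // u _; rewrite !mxE.
Qed.

Lemma Phi_C1 b : C1 setT (fun z : 'rV[R]_5 => coord b
  (Phi d (z 0 0) (State (z 0 1) (z 0 2) (z 0 3) (toS1 (z 0 4))))).
Proof. by have [/Ck_C1 H1 /Ck_C1 H2] := Phi_C2 S; case: b. Qed.

Lemma Phi_chain b t0 x0 y0 e S0 : exists Pt Px Py Ps,
  forall B x t X Y s vt vx vy vs, B x -> t x = t0 -> X x = x0 -> Y x = y0 ->
  s x = S0 -> slope_cvg B t x vt -> slope_cvg B X x vx -> slope_cvg B Y x vy ->
  slope_cvg B s x vs ->
  slope_cvg B (fun u => coord b (Phi d (t u) (State (X u) (Y u) e (toS1 (s u))))) x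
    (Pt * vt + Px * vx + Py * vy + Ps * vs).
Proof.
pose F := fun z : 'rV[R]_5 => coord b
  (Phi d (z 0 0) (State (z 0 1) (z 0 2) (z 0 3) (toS1 (z 0 4)))).
pose W k := partial_within setT k F (pt 5 [:: t0; x0; y0; e; S0]).
exists (W ord0), (W (lift ord0 ord0)), (W (lift ord0 (lift ord0 ord0))),
  (W (lift ord0 (lift ord0 (lift ord0 (lift ord0 ord0))))).
move=> B x t X Y s vt vx vy vs Bx tx Xx Yx sx dt dX dY ds.
pose P u := pt 5 [:: t u; X u; Y u; e; s u].
have dP (j : 'I_5) :
    slope_cvg B (fun u => P u 0 j) x (nth 0 [:: vt; vx; vy; 0; vs] j).
  case: j => -[|[|[|[|[|//]]]]] jlt /=; under eq_fun do rewrite mxE /=;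
    [exact: dt|exact: dX|exact: dY|exact: slope_cvg_cst|exact: ds].
have Dbox : box_convex [set: 'rV[R]_5] by [].
have := slope_cvg_comp Dbox (@Phi_C1 b) Bx (fun _ _ => I) dP.
rewrite !big_ord_recl big_ord0 /= /P tx Xx Yx sx mulr0 add0r addr0 !addrA.
by apply: eq_slope_cvg => // u _; rewrite !mxE.
Qed.

Lemma state_eta (q : state R) : q = State (pix q) (piy q) (pieps q) (pis q).
Proof. by case: q. Qed.

Lemma wlocE i r e s : Irad i r -> E e -> wloc d i r e s =
  State (pix (wloc d i r e s)) (piy (wloc d i r e s)) e s.
Proof.
by move=> Ir Ee; have [e1 s1] := wloc_eps_s S s Ir Ee; rewrite [LHS]state_eta e1 s1.
Qed.

Lemma Phi_wloc_chain b i t0 r0 e S0 : E e -> exists Pt Hr Hs,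
  forall B x t r s vt vr vs, B x -> t x = t0 -> r x = r0 -> s x = S0 ->
  (forall u, B u -> Irad i (r u)) ->
  slope_cvg B t x vt -> slope_cvg B r x vr -> slope_cvg B s x vs ->
  slope_cvg B (fun u => coord b (Phi d (t u) (wloc d i (r u) e (toS1 (s u))))) x
    (Pt * vt + Hr * vr + Hs * vs).
Proof.
move=> Ee; have [Wrx [Wsx Wx]] := wloc_chain i true r0 S0 Ee.
have [Wry [Wsy Wy]] := wloc_chain i false r0 S0 Ee.
pose q0 := wloc d i r0 e (toS1 S0).
have [Pt [Px [Py [Ps PP]]]] := Phi_chain b t0 (pix q0) (piy q0) e S0.
exists Pt, (Px * Wrx + Py * Wry), (Px * Wsx + Py * Wsy + Ps).
move=> B x t r s vt vr vs Bx tx rx sx rB dt dr ds.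
have := PP _ _ _ _ _ _ _ _ _ _ Bx tx _ _ sx dt (Wx _ _ _ _ _ _ Bx rx sx rB dr ds)
  (Wy _ _ _ _ _ _ Bx rx sx rB dr ds) ds.
rewrite rx sx => /(_ erefl erefl).
have -> : Pt * vt + Px * (Wrx * vr + Wsx * vs) + Py * (Wry * vr + Wsy * vs) + Ps * vs
  = Pt * vt + (Px * Wrx + Py * Wry) * vr + (Px * Wsx + Py * Wsy + Ps) * vs by ring.
apply: eq_slope_cvg => // u Bu; congr (coord b (Phi d _ _)).
by rewrite [RHS]wlocE //; apply: rB.
Qed.

Lemma field_slope b t q : slope_cvg setT (fun u => coord b (Phi d u q)) t
  (if b then (field d (Phi d t q)).1 else (field d (Phi d t q)).2).
Proof.
have [_ _ /(_ q)[th [_ /(_ t)[hx hy _ _]]]] := Phi_flow S.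
by case: b; apply/is_derive_slope.
Qed.

Lemma Phi_eps t q : pieps (Phi d t q) = pieps q.
Proof.
have [Phi0 _ /(_ q)[th [_ H]]] := Phi_flow S.
rewrite -[in RHS](Phi0 q); apply: (@is_derive_0_is_cst _ (fun u => pieps (Phi d u q))).
by move=> x; have [] := H x.
Qed.

Lemma Phi_s t q : pis (Phi d t q) = pis q + toS1 t.
Proof.
have [Phi0 _ /(_ q)[th [thE H]]] := Phi_flow S.
(* The lifted angle has derivative 1, so [th u - u] is constant. *)
have : th t - t = th 0 - 0.
  apply: (@is_derive_0_is_cst _ (fun u => th u - u)) => x.
  have [_ _ _ dth] := H x; rewrite -(subrr 1); exact: is_deriveB.
rewrite subr0 => /eqP; rewrite subr_eq => /eqP tE.
by rewrite thE tE toS1D -thE Phi0.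
Qed.

End Dynamics.

(** * Frames and half-orbits in the local manifolds *)

Section Manifolds.
Variables (R : realType) (d : splitting_data R).
Hypothesis S : splitting_setting d.

Local Notation E := (E d).
Local Notation Irad := (Irad d).

Lemma rad_in i : Irad i (Defs.rad d i).
Proof. by rewrite /Defs.Irad /= in_itv /= lexx ge0_cp ?ltW// (rad_gt0 S). Qed.

Lemma proper_Irad i r : Irad i r -> ProperFilter (within (Irad i `\ r) (nbhs r)).
Proof.
move=> Ir; have [r0|r0] := eqVneq r 0.
  apply: (@proper_within _ _ r (Defs.rad d i)) => //; first exact: ordconvex_itv.
    exact: rad_in.
  by rewrite r0 lt_eqF ?(rad_gt0 S).
apply: (@proper_within _ _ r 0) => //; first exact: ordconvex_itv.
have := rad_gt0 S i; rewrite /Defs.Irad /= in_itv /= => h; apply/andP; split; lra.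
Qed.

Definition planar (b : bool) (v : R * R) : R := if b then v.1 else v.2.

(** Three test curves, varying only [t], only [r] and only [s], identify the coefficients of the
    chain rule as the field and the two frame vectors. *)
Lemma Phi_wloc_frame b i t0 r0 e S0 : E e -> Irad i r0 ->
  forall B x t r s vt vr vs, B x -> t x = t0 -> r x = r0 -> s x = S0 ->
  (forall u, B u -> Irad i (r u)) ->
  slope_cvg B t x vt -> slope_cvg B r x vr -> slope_cvg B s x vs ->
  slope_cvg B (fun u => coord b (Phi d (t u) (wloc d i (r u) e (toS1 (s u))))) x
    (planar b (field d (Phi d t0 (wloc d i r0 e (toS1 S0)))) * vt
     + planar b (frame_r d i e t0 r0 (toS1 S0)).1 * vr
     + planar b (frame_s d i e t0 r0 (toS1 S0)).1 * vs).
Proof.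
move=> Ee Ir0; have [Pt [Hr [Hs H]]] := Phi_wloc_chain S b i t0 r0 S0 Ee.
have <- : Pt = planar b (field d (Phi d t0 (wloc d i r0 e (toS1 S0)))).
  have := H setT t0 id (fun=> r0) (fun=> S0) 1 0 0 I erefl erefl erefl
    (fun _ _ => Ir0) (slope_cvg_id _ _) (slope_cvg_cst _ _ _) (slope_cvg_cst _ _ _).
  rewrite !mulr0 !addr0 mulr1 => /(slope_cvg_unique (proper_setT t0)); apply.
  exact: (field_slope S).
have <- : Hr = planar b (frame_r d i e t0 r0 (toS1 S0)).1.
  have := H (Irad i) r0 (fun=> t0) id (fun=> S0) 0 1 0 Ir0 erefl erefl erefl
    (fun _ => id) (slope_cvg_cst _ _ _) (slope_cvg_id _ _) (slope_cvg_cst _ _ _).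
  rewrite !mulr0 add0r addr0 mulr1 => /(dwithinE (proper_Irad Ir0)) <-.
  by rewrite /coord; case: b {H}.
have <- : Hs = planar b (frame_s d i e t0 r0 (toS1 S0)).1.
  have := H setT 0 (fun=> t0) (fun=> r0) (fun u => S0 + u) 0 0 1 I erefl erefl
    (addr0 _) (fun _ _ => Ir0) (slope_cvg_cst _ _ _) (slope_cvg_cst _ _ _)
    (slope_cvg_shift _ _ _).
  rewrite !mulr0 !add0r mulr1 => /slope_cvg_derive1 <-.
  under eq_fun do rewrite toS1D.
  by rewrite /coord; case: b {H}.
exact: H.
Qed.

(* The times at which the flow maps [Wloc i] into itself. *)
Definition backward i : set R :=
  match i with unst => [set u | u <= 0] | stab => [set u | 0 <= u] end.

Lemma backward0 i : backward i 0.
Proof. by case: i => /=. Qed.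

Lemma proper_backward i : ProperFilter (within (backward i `\ 0) (nbhs 0)).
Proof.
apply: (@proper_within _ _ _ (if i is unst then -1 else 1)); [|exact: backward0|..].
- move=> a b c; case: i => /= a0 b0 /andP[].
    by rewrite le_max => _ /orP[] /le_trans; apply.
  by rewrite ge_min => /orP[] h _; apply: le_trans h.
- by case: i => /=; rewrite ?lerN10.
- by case: i; rewrite eq_sym ?oppr_eq0 oner_eq0.
Qed.

Lemma Wloc_invariant i u q : backward i u -> Wloc d i q -> Wloc d i (Phi d u q).
Proof.
have [_ PhiD _] := Phi_flow S.
case: i => /= u0 Wq t t0; rewrite -PhiD; apply: Wq.
  by rewrite -(addr0 0) lerD.
by rewrite addr_ge0.
Qed.

Lemma Wloc_wloc i r e s : Irad i r -> E e -> Wloc d i (wloc d i r e s).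
Proof. by move=> Ir Ee; rewrite (wloc_image S); exists r, e, s. Qed.

(** The half-orbit stays in [Wloc], hence in the image of [wloc]. Its parameter is constant and its
    angle advances at unit speed, so only the coordinate [r] remains to be chosen; nothing is known
    yet about its regularity. *)
Lemma backward_orbit i r0 e S0 : E e -> Irad i r0 -> exists r : R -> R,
  r 0 = r0 /\ forall u, backward i u -> Irad i (r u) /\
    Phi d u (wloc d i r0 e (toS1 S0)) = wloc d i (r u) e (toS1 (S0 + u)).
Proof.
move=> Ee Ir0.
have H u : exists r, backward i u -> Irad i r /\
    Phi d u (wloc d i r0 e (toS1 S0)) = wloc d i r e (toS1 (S0 + u)).
  have [bu|nbu] := pselect (backward i u); last by exists 0.
  have := Wloc_invariant bu (Wloc_wloc (toS1 S0) Ir0 Ee).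
  rewrite (wloc_image S) => -[r [e' [s [Ir Ee' qE]]]].
  exists r => _; split=> //; rewrite qE.
  have [we ws] := wloc_eps_s S s Ir Ee'.
  have [we0 ws0] := wloc_eps_s S (toS1 S0) Ir0 Ee.
  have <- : e' = e by rewrite -we -qE (Phi_eps S) we0.
  by congr wloc; rewrite -ws -qE (Phi_s S) ws0 toS1D.
have [r rP] := choice H; exists r; split=> //.
have [Ir E0] := rP 0 (backward0 i).
have [Phi0 _ _] := Phi_flow S.
move: E0; rewrite Phi0 addr0 => /esym E0.
exact: (wloc_inj S Ir Ir0 Ee E0).
Qed.

Lemma wloc_near b i r1 e s1 eps : E e -> Irad i r1 -> 0 < eps ->
  exists2 eta, 0 < eta & forall r u, Irad i r -> `|r - r1| < eta -> `|u| < eta ->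
    `|coord b (wloc d i r e (toS1 (s1 + u))) - coord b (wloc d i r1 e (toS1 s1))|
      < eps.
Proof.
move=> Ee Ir1 eps0.
have /subspace_continuousP : {within [set z : 'rV[R]_3 | Irad i (z 0 0) /\ E (z 0 1)],
    continuous (fun z => coord b (wloc d i (z 0 0) (z 0 1) (toS1 (z 0 2))))}.
  by have [/Ck_continuous H1 /Ck_continuous H2] := wloc_C2 S i; case: (b).
move=> /(_ (pt 3 [:: r1; e; s1])) /=; rewrite !mxE => /(_ (conj Ir1 Ee)).
move=> /cvgrPdist_lt/(_ _ eps0); rewrite /within /= => /nbhs_ballP[eta /= eta0 H].
exists eta => // r u Ir rr uu.
have := H (pt 3 [:: r; e; s1 + u]); rewrite /from_subspace !mxE /= => Hp.
rewrite distrC; apply: Hp => //.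
split=> // a j; rewrite ord1 !mxE -ball_normE /=.
case: j => -[|[|[|//]]] jlt /=; rewrite ?subrr ?normr0//; first by rewrite distrC.
by rewrite opprD addNKr normrN.
Qed.

Lemma eq_state (p q : state R) : pix p = pix q -> piy p = piy q ->
  pieps p = pieps q -> pis p = pis q -> p = q.
Proof. by case: p q => [? ? ? ?] [? ? ? ?] /= -> -> -> ->. Qed.

(* By compactness [r] has a cluster point, and injectivity of [wloc] leaves
   [r0] as the only candidate. *)
Lemma backward_orbit_cvg i r0 e S0 (r : R -> R) : E e -> Irad i r0 ->
  (forall u, backward i u -> Irad i (r u) /\
    Phi d u (wloc d i r0 e (toS1 S0)) = wloc d i (r u) e (toS1 (S0 + u))) ->
  r u @[u --> within (backward i) (nbhs 0)] --> r0.
Proof.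
move=> Ee Ir0 rP; apply/cvgrPdist_lt => eps eps0.
apply: contrapT => nF.
pose F := within (backward i) (nbhs (0 : R)).
(* [G] restricts the times to those at which [r] stays [eps] away from [r0]; if convergence fails,
   this filter is proper and [r] has a cluster point [r1] along it. *)
pose G := within [set u | ~ `|r0 - r u| < eps] F.
have FG : ProperFilter G.
  apply: Build_ProperFilter => H.
  apply: nF; change (F (fun u => ~ `|r0 - r u| < eps -> set0 u)) in H.
  by apply: filterS H => u /contrapT.
have GA (A : set R) eta : 0 < eta -> (forall u, backward i u -> `|u| < eta ->
    ~ `|r0 - r u| < eps -> A u) -> G A.
  move=> eta0 AP; apply/nbhs_ballP; exists eta => //= u.
  by rewrite -ball_normE /= sub0r normrN => uu bu nu; apply: AP.
have GI : (r @ G) (Irad i).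
  by apply: (GA _ 1) => // u bu _ _; apply: (rP u bu).1.
have [r1 [Ir1 r1cl]] := @segment_compact R _ _ (r @ G) _ GI.
have near_r1 eta : 0 < eta -> exists u, [/\ backward i u, `|u| < eta,
    `|r u - r1| < eta & ~ `|r0 - r u| < eps].
  move=> eta0.
  have Gu : (r @ G) (r @` [set u | [/\ backward i u, `|u| < eta &
      ~ `|r0 - r u| < eps]]).
    by apply: (GA _ eta) => // u bu uu nu; exists u.
  have [_ [[u [bu uu nu] <-]]] := r1cl _ _ Gu (nbhsx_ballx r1 _ eta0).
  by rewrite -ball_normE /= distrC => ur; exists u.
(* At suitable small times [u] the point [Phi d u w] of the half-orbit from [w] is near [w] by
   continuity of the flow, and near the point of parameter [r1] by continuity of [wloc]. *)
have eqb b : coord b (wloc d i r1 e (toS1 S0)) = coord b (wloc d i r0 e (toS1 S0)).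
  apply/eqP; rewrite -subr_eq0 -normr_eq0 eq_le normr_ge0 andbT.
  apply/ler_addgt0Pl => x x0; rewrite addr0.
  have x2 : 0 < x / 2 by rewrite divr_gt0.
  have [e1 e10 H1] := wloc_near b S0 Ee Ir1 x2.
  have /slope_cvg_within/cvgrPdist_lt/(_ _ x2) :=
    @field_slope _ _ S b 0 (wloc d i r0 e (toS1 S0)).
  rewrite /within /= => /nbhs_ballP[e2 /= e20 H2].
  have e0 : 0 < Num.min e1 e2 by rewrite lt_min e10.
  have [u [bu + + _]] := near_r1 _ e0; rewrite !lt_min => /andP[ue1 ue2] /andP[re1 _].
  have := H1 _ _ (rP u bu).1 re1 ue1.
  have := H2 u; rewrite -ball_normE /= sub0r normrN => /(_ ue2 I).
  have [Phi0 _ _] := Phi_flow S; rewrite Phi0 (rP u bu).2.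
  set p := coord b _; set q := coord b _; set s := coord b _ => h1 h2.
  rewrite (_ : s - p = - (q - s) - (p - q)); last by ring.
  apply: (le_trans (ler_normB _ _)); rewrite normrN; lra.
have r10 : r1 = r0.
  apply: (wloc_inj S Ir1 Ir0 Ee (s := toS1 S0)).
  have [a1 b1] := wloc_eps_s S (toS1 S0) Ir1 Ee.
  have [a2 b2] := wloc_eps_s S (toS1 S0) Ir0 Ee.
  by apply: eq_state; rewrite ?a1 ?a2 ?b1 ?b2//; [apply: (eqb true)|apply: (eqb false)].
have [u [_ _]] := near_r1 _ eps0.
by rewrite r10 distrC.
Qed.
End Manifolds.

(** * Tangent planes *)

Section Tangents.
Variables (R : realType) (d : splitting_data R).
Hypothesis S : splitting_setting d.

Local Notation E := (E d).
Local Notation Irad := (Irad d).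

(** An implicit differentiation: the orbit has a velocity, [wloc] has a nonzero [r]-derivative in
    some coordinate, and the Caratheodory formula can be solved for the difference quotient of
    [r]. *)
Lemma backward_orbit_slope i r0 e S0 (r : R -> R) : E e -> Irad i r0 -> r 0 = r0 ->
  (forall u, backward i u -> Irad i (r u) /\
    Phi d u (wloc d i r0 e (toS1 S0)) = wloc d i (r u) e (toS1 (S0 + u))) ->
  exists a, slope_cvg (backward i) r 0 a.
Proof.
move=> Ee Ir0 r00 rP.
have rc := backward_orbit_cvg S Ee Ir0 rP.
pose D := [set z : 'rV[R]_3 | Irad i (z 0 0) /\ E (z 0 1)].
pose F b := fun z : 'rV[R]_3 => coord b (wloc d i (z 0 0) (z 0 1) (toS1 (z 0 2))).
pose P u := pt 3 [:: r u; e; S0 + u].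
have PD u : backward i u -> D (P u).
  by move=> bu; split; rewrite mxE //=; apply: (rP u bu).1.
have partE b : partial_within D ord0 (F b) (P 0) =
    dwithin (Irad i) (fun r' => coord b (wloc d i r' e (toS1 S0))) r0.
  rewrite /partial_within mxE /= r00; congr dwithin.
    apply/seteqP; split=> u; rewrite /D /= !setcoordE !mxE /=; first by case.
    by split.
  by apply/funext => u; rewrite /F !setcoordE !mxE /= addr0.
(* Regularity of the parameterization provides the coordinate in which to divide. *)
have [b W0] : exists b, partial_within D ord0 (F b) (P 0) != 0.
  apply: contrapT => H.
  have Hb b : partial_within D ord0 (F b) (P 0) = 0.
    by apply: contrapT => /eqP ?; apply: H; exists b.
  apply: (wloc_regular S Ir0 Ee (s := toS1 S0)).
  by have := Hb true; have := Hb false; rewrite !partE /coord => -> ->.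
have [A [FE AF]] := caratheodory (@wloc_box _ d i) (@wloc_C1 _ _ S b i)
  (PD 0 (backward0 R i)).
have Pc : P u @[u --> within (backward i) (nbhs 0)] --> within D (nbhs (P 0)).
  apply: cvg_curve PD _ => j; rewrite mxE.
  under eq_fun do rewrite mxE.
  case: j => -[|[|[|//]]] jlt /=.
  - by rewrite r00.
  - exact: cvg_cst.
  - exact: slope_cvg_within (slope_cvg_shift _ S0 0).
pose w := wloc d i r0 e (toS1 S0).
pose k0 : 'I_3 := ord0.
pose k2 : 'I_3 := lift ord0 (lift ord0 ord0).
have APc k : A k (P u) @[u --> within (backward i `\ 0) (nbhs 0)] -->
    partial_within D k (F b) (P 0).
  have := cvg_comp _ _ Pc (AF k); apply: cvg_trans; apply: cvg_app.
  by apply: within_subset => y [].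
pose v := planar b (field d w).
have Fv : slope_cvg (backward i) (fun u => coord b (Phi d u w)) 0 v.
  have := @field_slope _ _ S b 0 w.
  have [-> _ _] := Phi_flow S.
  exact: (@slope_cvg_sub _ setT).
have slopeE u : backward i u -> u != 0 ->
    (coord b (Phi d u w) - coord b (Phi d 0 w)) / (u - 0) =
    A k0 (P u) * ((r u - r 0) / (u - 0)) + A k2 (P u).
  move=> bu u0; have [Phi0 _ _] := Phi_flow S.
  have := FE _ (PD _ bu); rewrite !big_ord_recl big_ord0 !mxE /= r00.
  rewrite (rP u bu).2 Phi0 !addr0 subrr mulr0 add0r addrAC subrr add0r subr0 => ->.
  by rewrite mulrDl -mulrA mulfK.
(* The solution [a] of [v = W_r a + W_s], where [W_r] and [W_s] are the partial derivatives in [r]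
   and [s]. *)
exists ((v - partial_within D k2 (F b) (P 0)) / partial_within D k0 (F b) (P 0)).
rewrite /slope_cvg.
have : ((coord b (Phi d u w) - coord b (Phi d 0 w)) / (u - 0) - A k2 (P u))
      / A k0 (P u) @[u --> within (backward i `\ 0) (nbhs 0)] -->
    (v - partial_within D k2 (F b) (P 0)) / partial_within D k0 (F b) (P 0).
  apply: cvgM; last by apply: cvgV => //; apply: APc.
  by apply: cvgB => //; apply: APc.
apply: cvg_trans; apply: near_eq_cvg.
have : \forall u \near within (backward i `\ 0) (nbhs 0), A k0 (P u) != 0.
  have /cvgrPdist_lt := APc k0.
  move=> /(_ `|partial_within D k0 (F b) (P 0)|); rewrite normr_gt0 => /(_ W0).
  rewrite !near_withinE; apply: filterS => u H bu; move: (H bu).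
  by apply: contraTneq => ->; rewrite subr0 ltxx.
rewrite !near_withinE; apply: filterS => u Au [bu u0].
have {}Au := Au (conj bu u0).
by rewrite slopeE ?addrK 1?mulrC ?mulKf//; apply/eqP.
Qed.

(* The manifold is invariant along the half-orbit on which it is defined, so
   the extended vector field is tangent to it even at the boundary r = rad. *)
Lemma field_frame i t r0 e s : E e -> Irad i r0 -> exists a, forall b,
  planar b (field d (Phi d t (wloc d i r0 e s))) =
  a * planar b (frame_r d i e t r0 s).1 + planar b (frame_s d i e t r0 s).1.
Proof.
move=> Ee Ir0; rewrite -(toS1_repr s); set S0 := repr s.
have [r [r00 rP]] := backward_orbit S S0 Ee Ir0.
have [a ra] := backward_orbit_slope Ee Ir0 r00 rP.
exists a => b.
have [Phi0 PhiD _] := Phi_flow S.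
have := @Phi_wloc_frame _ _ S b i t r0 e S0 Ee Ir0 (backward i) 0 (fun=> t) r
  (fun u => S0 + u) 0 a 1 (backward0 R i) erefl r00 (addr0 _)
  (fun u bu => (rP u bu).1) (slope_cvg_cst _ _ _) ra (slope_cvg_shift _ _ _).
rewrite mulr0 add0r mulr1 mulrC => H.
apply: (slope_cvg_unique (proper_backward R i)) H.
(* Since flow maps commute, the image under time [t] of the half-orbit is the half-orbit of the
   image, whose velocity is the field there. *)
have := @field_slope _ _ S b 0 (Phi d t (wloc d i r0 e (toS1 S0))).
rewrite Phi0 => /(@slope_cvg_sub _ setT (backward i)) => /(_ (fun _ _ => I)).
apply: eq_slope_cvg; first exact: backward0.
by move=> u bu; rewrite -(rP u bu).2 -!PhiD addrC.
Qed.

(** The first hit is an extremal element of the set of hitting times, so the infimum or supremum is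
    attained at it. *)
Lemma thit_spec i r e s : 0 < r <= Defs.rad d i -> E e ->
  let q := wloc d i r e s in
  [/\ side_time i (thit d i q), piy (Phit d i q) = 0 & (field d (Phit d i q)).2 != 0].
Proof.
move=> r0 Ee q; have := hit_transversal S s r0 Ee.
case: i r0 @q => r0 q [t [t0 St tmin ft]].
  suff tE : thit d unst q = t by rewrite /Phit tE; split=> //; apply: ltW.
  rewrite /thit; apply/eqP; rewrite eq_le; apply/andP; split.
    apply: ge_inf => //; exists 0 => x [x0 _]; exact: ltW.
  apply: lb_le_inf; first by exists t.
  by move=> x [x0 Sx]; rewrite leNgt; apply/negP => xt; apply: (tmin x) => //; rewrite x0.
suff tE : thit d stab q = t by rewrite /Phit tE; split=> //; apply: ltW.
rewrite /thit; apply/eqP; rewrite eq_le; apply/andP; split.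
  apply: ge_sup; first by exists t.
  by move=> x [x0 Sx]; rewrite leNgt; apply/negP => xt; apply: (tmin x) => //; rewrite x0 xt.
by apply: ub_le_sup => //; exists 0 => x [x0 _]; exact: ltW.
Qed.

Lemma rad_pos i : 0 < Defs.rad d i <= Defs.rad d i.
Proof. by rewrite (rad_gt0 S) lexx. Qed.

Lemma psec_spec i e t : E e ->
  [/\ Weps d i e (psec d i e t), piy (psec d i e t) = 0,
      (field d (psec d i e t)).2 != 0, pieps (psec d i e t) = e &
      pis (psec d i e t) = t].
Proof.
move=> Ee; have [ti Si fi] := thit_spec (kappa d i e t) (rad_pos i) Ee.
have [we ws] := wloc_eps_s S (kappa d i e t) (rad_in S i) Ee.
have pe : pieps (psec d i e t) = e by rewrite /psec /Phit (Phi_eps S).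
split=> //; last by rewrite /psec /Phit (Phi_s S) -[RHS](kappa_spec S i t Ee).
split=> //; eexists; eexists; split; [exact: ti| |by []].
exact: (Wloc_wloc S _ (rad_in S i) Ee).
Qed.

Lemma kappa_lift_slope i e T0 : E e -> exists k kv,
  (forall u, kappa d i e (toS1 (T0 + u)) = toS1 (k u)) /\ slope_cvg setT k 0 kv.
Proof.
move=> Ee; have [G [/Ck_C1 G1 GE]] := kappa_C2 S i.
pose P u := pt 2 [:: e; T0 + u].
have PD u : [set z : 'rV[R]_2 | E (z 0 0)] (P u) by rewrite /= mxE.
exists (G \o P); eexists; split.
  by move=> u; have := GE _ (PD u); rewrite !mxE.
apply: (@slope_cvg_comp _ _ [set z : 'rV[R]_2 | E (z 0 0)] _ _ _ _
   (fun j => nth 0 [:: 0; 1] j)) => //.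
  by move=> p q z Dp Dq /(_ 0); apply: ordconvex_itv.
case=> -[|[|//]] jlt /=; under eq_fun do rewrite mxE /=.
  exact: slope_cvg_cst.
exact: slope_cvg_shift.
Qed.

Lemma thit_slope i e s x v : E e -> slope_cvg setT s x v -> exists w,
  slope_cvg setT (fun u => thit d i (wloc d i (Defs.rad d i) e (toS1 (s u)))) x w.
Proof.
move=> Ee ds; have /Ck_C1 T1 := thit_C2 S i.
pose P u := pt 3 [:: Defs.rad d i; e; s u].
pose D := [set z : 'rV[R]_3 | 0 < z 0 0 <= Defs.rad d i /\ E (z 0 1)].
have PD u : D (P u) by rewrite /D /= !mxE /= (rad_pos i).
eexists.
have := @slope_cvg_comp _ _ D _ setT P x
   (fun j => nth 0 [:: 0; 0; v] j) _ T1 I (fun u _ => PD u).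
have Dc : box_convex D.
  move=> p q z [/andP[p0 pr] pe] [/andP[q0 qr] qe] zb; split; last first.
    exact: (ordconvex_itv pe qe (zb 1)).
  have /andP[] := zb 0; rewrite ge_min le_max => z1 z2; apply/andP; split.
    by case/orP: z1; apply: lt_le_trans.
  by case/orP: z2 => /le_trans; apply.
move=> /(_ Dc) H.
apply: (eq_slope_cvg _ _ (H _)) => // [u _|]; first by rewrite !mxE.
case=> -[|[|[|//]]] jlt /=; under eq_fun do rewrite mxE /=;
  [exact: slope_cvg_cst|exact: slope_cvg_cst|exact: ds].
Qed.

(** By continuity [f u] and [f 0 + u] differ by less than [2 * pi] near 0, so their equality on the
    circle lifts to the line. *)
Lemma toS1_slope (f : R -> R) v : slope_cvg setT f 0 v ->
  (forall u, toS1 (f u) = toS1 (f 0 + u)) -> v = 1.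
Proof.
move=> fv fE.
have fc : f u @[u --> (0 : R)] --> f 0.
  apply: differentiable_continuous.
  by apply/derivable1_diffP; have [] := (is_derive_slope _ _ _).2 fv.
have : \forall u \near (0 : R), f u = f 0 + u.
  have pi0 : 0 < pi :> R by rewrite pi_gt0.
  have /cvgrPdist_lt/(_ _ pi0) := fc.
  have n0 : \forall u \near (0 : R), `|u| < pi.
    by apply/nbhs_ballP; exists pi => //= u; rewrite -ball_normE /= sub0r normrN.
  apply: filter_app; near=> u => fu.
  apply: toS1_inj_small (fE u).
  have -> : f u - (f 0 + u) = - (f 0 - f u) - u by ring.
  apply: (le_lt_trans (ler_normB _ _)); rewrite normrN mulr_natl mulr2n.
  by apply: ltrD => //; near: u.
move=> H.
apply: (slope_cvg_unique (proper_setT 0) fv).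
apply: (slope_cvg_near (A := [set u | f u = f 0 + u])) => //.
apply: eq_slope_cvg (slope_cvg_shift _ (f 0) 0) => [|u //=].
by rewrite /= addr0.
Unshelve. all: by end_near. Qed.

(** The vectors are [al (p', 0, 1) + be (f, 1)], with [p'] the slope of the section curve. All
    combinations are given at once because [tangent] is a union over representations of the point,
    where sums are not immediate. *)
Lemma psec_slope i e T0 : E e -> exists p', slope_cvg setT
    (fun u => pix (psec d i e (toS1 (T0 + u)))) 0 p' /\
  forall al be : R, tangent d i e (psec d i e (toS1 T0))
    (al * p' + be * (field d (psec d i e (toS1 T0))).1,
     be * (field d (psec d i e (toS1 T0))).2, al + be).
Proof.
move=> Ee; have [k [kv [kE dk]]] := kappa_lift_slope i T0 Ee.
have [tv dt] := thit_slope i Ee dk.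
set q := psec _ _ _ _.
have k0E : kappa d i e (toS1 T0) = toS1 (k 0) by rewrite -kE addr0.
set t := fun u => thit d i _ in dt.
have qE : q = Phi d (t 0) (wloc d i (Defs.rad d i) e (toS1 (k 0))).
  by rewrite /q /psec /Phit k0E.
(* The starting angle plus the travel time is the arrival angle [T0 + u]. *)
have vE : kv + tv = 1.
  apply: (@toS1_slope (fun u => k u + 1 * t u)).
    by have := slope_cvg_lin (a := 1) dk dt; rewrite mul1r.
  move=> u; rewrite !mul1r toS1D.
  have Te u' : toS1 (k u') + toS1 (t u') = toS1 (T0 + u').
    rewrite -kE -[RHS](kappa_spec S i _ Ee) /tauhit /t -kE; congr (_ + _).
    by rewrite (wloc_eps_s S _ (rad_in S i) Ee).2.
  by rewrite Te toS1D (toS1D (_ + _)) toS1D Te addr0.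
have ds b := @Phi_wloc_frame _ _ S b i (t 0) (Defs.rad d i) e (k 0) Ee (rad_in S i)
  setT 0 t (fun=> Defs.rad d i) k tv 0 kv I erefl erefl erefl
  (fun _ _ => rad_in S i) dt (slope_cvg_cst _ _ _) dk.
rewrite -qE in ds; move: ds.
set fr := frame_r _ _ _ _ _ _; set fs := frame_s _ _ _ _ _ _ => ds.
have ps u : psec d i e (toS1 (T0 + u)) =
    Phi d (t u) (wloc d i (Defs.rad d i) e (toS1 (k u))).
  by rewrite /psec /Phit kE.
have dsx := ds true; have dsy := ds false.
rewrite !mulr0 !addr0 /planar in dsx dsy.
(* The section curve remains in [y = 0], so its velocity has no [y] component. *)
have y0 : (field d q).2 * tv + fs.1.2 * kv = 0.
  apply: (slope_cvg_unique (proper_setT 0) dsy).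
  apply: eq_slope_cvg (slope_cvg_cst _ 0 _) => // u _.
  by rewrite -ps /coord; have [_ ->] := psec_spec i (toS1 (T0 + u)) Ee.
have [a fE] := field_frame (t 0) (toS1 (k 0)) Ee (rad_in S i).
rewrite -qE -/fr -/fs in fE; have fx := fE true; have fy := fE false.
rewrite /planar in fx fy.
exists ((field d q).1 * tv + fs.1.1 * kv); split.
  by apply: eq_slope_cvg dsx => // u _; rewrite ps.
move=> al be; exists (t 0), (Defs.rad d i), (toS1 (k 0)); split=> //.
- by have [] := thit_spec (toS1 (k 0)) (rad_pos i) Ee.
- exact: rad_in.
(* The section velocity is [tv f + kv fs] and the field is [f = a fr + fs]; these are the
   coefficients of [fr] and [fs] in the combination. *)
exists ((al * tv + be) * a), (al * kv + al * tv + be).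
rewrite -/fr -/fs.
have fr3 : fr.2 = 0 by [].
have fs3 : fs.2 = 1 by [].
move: fx fy y0; move: (field d q).1 (field d q).2 => f1 f2 fx fy y0.
case: fr fs fr3 fs3 fx fy y0 {ds dsx dsy fE} => -[frx fry] frs [[fsx fsy] fss] /=.
move=> -> -> fx fy y0.
set x := (al * tv + be) * a; set y := al * kv + al * tv + be.
transitivity (x * frx + y * fsx, x * fry + y * fsy, x * 0 + y * 1); last by [].
rewrite /x /y; congr (_, _, _).
- by rewrite fx; ring.
- transitivity (be * f2 + al * (f2 * tv + fsy * kv)).
    by rewrite y0 mulr0 addr0.
  by rewrite fy; ring.
- by rewrite mulr0 add0r mulr1 -mulrDr vE mulr1.
Qed.
End Tangents.

(** * The splitting function *)

Section Splitting.
Variables (R : realType) (d : splitting_data R).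
Hypothesis S : splitting_setting d.

Local Notation E := (E d).

Let D : set 'rV[R]_2 := [set z | E (z 0 0)].
Let F (z : 'rV[R]_2) := delta d (z 0 0) (toS1 (z 0 1)).

Lemma ordconvex_E : ordconvex E.
Proof. exact: ordconvex_itv. Qed.

Lemma E0 : E 0.
Proof. by have /andP[? ?] := E_around_0 S; rewrite /Defs.E /= in_itv/= !ltW. Qed.

Lemma proper_E e : E e -> ProperFilter (within (E `\ e) (nbhs e)).
Proof.
move=> Ee; have /andP[m0 M0] := E_around_0 S.
have [e0|e0] := eqVneq e 0; last exact: (proper_within ordconvex_E Ee E0).
apply: (@proper_within _ _ _ (Emax d)) => //; first exact: ordconvex_E.
  by rewrite /Defs.E /= in_itv/= lexx andbT ltW// (lt_trans m0).
by rewrite e0 lt_eqF.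
Qed.

Let G := partial_within D ord0 F.
Let i1 : 'I_2 := lift ord0 ord0.

Lemma d_eps_deltaE e t : d_eps_delta d e (toS1 t) = G (pt 2 [:: e; t]).
Proof.
rewrite /G /partial_within mxE /=; congr dwithin.
  by apply/seteqP; split=> u; rewrite /D /= !setcoordE.
by apply/funext => u; rewrite /F !setcoordE !mxE.
Qed.

Lemma delta_eps_slope e t : E e ->
  slope_cvg E (fun e' => delta d e' (toS1 t)) e (d_eps_delta d e (toS1 t)).
Proof.
move=> Ee; have /(_ ord0)[/(_ (pt 2 [:: e; t])) + _] := Ck_C1 (delta_C2 S).
rewrite /= mxE => /(_ Ee) /derivable_within_slope.
rewrite d_eps_deltaE /G /partial_within !mxE /=.
have -> : [set u | E (setcoord (pt 2 [:: e; t]) ord0 u 0 0)] = E.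
  by apply/seteqP; split=> u; rewrite /= setcoordE.
by apply: eq_slope_cvg => // u _; rewrite !setcoordE !mxE.
Qed.

Lemma d_eps_delta_C1 : C1 D G.
Proof. by have [_ /(_ ord0)[_ H]] := delta_C2 S; exact: (@Ck_C1 _ 0 _ D G). Qed.

Lemma angle_slope (H : 'rV[R]_2 -> R) e t : C1 D H -> E e ->
  slope_cvg setT (fun u => H (pt 2 [:: e; u])) t
    (partial_within D i1 H (pt 2 [:: e; t])).
Proof.
move=> /(_ i1)[/(_ (pt 2 [:: e; t])) + _] Ee.
rewrite /D /= mxE => /(_ Ee) /derivable_within_slope.
rewrite /partial_within !mxE /=.
have -> : [set u | E (setcoord (pt 2 [:: e; t]) i1 u 0 0)] = setT.
  by apply/seteqP; split=> // u _; rewrite /= setcoordE mxE.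
apply: eq_slope_cvg => // u _; congr (H _).
by apply/rowP; case=> -[|[|//]] ilt; rewrite setcoordE !mxE.
Qed.

Lemma d_eps_delta_slope e t : E e ->
  slope_cvg setT (fun u => d_eps_delta d e (toS1 u)) t
    (partial_within D i1 G (pt 2 [:: e; t])).
Proof.
move=> Ee; have := @angle_slope G e t d_eps_delta_C1 Ee.
apply: eq_slope_cvg => // u _; by rewrite d_eps_deltaE.
Qed.

Lemma d_tau_eps_deltaE e t : E e ->
  d_tau_eps_delta d e (toS1 t) = partial_within D i1 G (pt 2 [:: e; t]).
Proof.
move=> Ee; apply: slope_cvg_derive1.
have /slope_cvg_shift_arg := @d_eps_delta_slope e t Ee.
by apply: eq_slope_cvg => // u _; rewrite toS1D.
Qed.

Lemma delta_eps_mvt e t : E e -> exists xi,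
  [/\ between 0 e xi, E xi & delta d e (toS1 t) = e * d_eps_delta d xi (toS1 t)].
Proof.
move=> Ee.
have [e' E' |xi xib] := mvt_within (f := fun e' => delta d e' (toS1 t)) ordconvex_E E0 Ee.
  by apply/cvg_ex; eexists; apply: (@delta_eps_slope e' t E').
rewrite (delta_0 S) !subr0 mulrC => ->; exists xi; split=> //.
exact: ordconvex_E E0 Ee xib.
Qed.

(** The increment in the angle vanishes at [eps = 0]. The mean value theorem is applied to it first
    in [eps], then in the angle at the resulting [xi], which produces the mixed derivative in
    exactly this order. *)
Lemma delta_mixed_mvt e a b : E e -> exists xi eta,
  [/\ E xi, between a b eta & delta d e (toS1 b) - delta d e (toS1 a) =
      e * (b - a) * d_tau_eps_delta d xi (toS1 eta)].
Proof.
move=> Ee.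
pose f e' := delta d e' (toS1 b) + (-1) * delta d e' (toS1 a).
have fs e' : E e' ->
    slope_cvg E f e' (d_eps_delta d e' (toS1 b) + (-1) * d_eps_delta d e' (toS1 a)).
  by move=> Ee'; apply: slope_cvg_lin; apply: delta_eps_slope.
have [e' E' |xi xib] := mvt_within (f := f) ordconvex_E E0 Ee.
  by apply/cvg_ex; eexists; apply: (fs _ E').
have Exi := ordconvex_E E0 Ee xib.
rewrite (dwithinE (proper_E Exi) (fs _ Exi)) /f !(delta_0 S) !mulN1r subrr !subr0.
have [t _ |eta etab] := @mvt_within _ setT (fun u => d_eps_delta d xi (toS1 u)) a b
  (fun _ _ _ _ _ _ => I) I I.
  by apply/cvg_ex; eexists; apply: (@d_eps_delta_slope xi t Exi).
rewrite (dwithinE (proper_setT eta) (@d_eps_delta_slope xi eta Exi)).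
rewrite -d_tau_eps_deltaE// => -> ->; exists xi, eta; split=> //.
by ring.
Qed.

(** The mixed derivative is continuous and attains its minimum on the compact rectangle [E] times
    [[a, b]]. *)
Lemma d_tau_eps_delta_lower_bound a b : a <= b ->
  (forall e t, E e -> a <= t <= b -> 0 < d_tau_eps_delta d e (toS1 t)) ->
  exists2 c, 0 < c &
    forall e t, E e -> a <= t <= b -> c <= d_tau_eps_delta d e (toS1 t).
Proof.
move=> ab pos.
pose A (i : 'I_2) : set R := if i == ord0 then E else `[a, b]%classic.
pose K : set 'rV[R]_2 := [set v | forall i, A i (v ord0 i)].
have KP v : K v -> E (v 0 0) /\ a <= v 0 i1 <= b.
  by move=> Kv; split; [apply: (Kv 0)|have := Kv i1; rewrite /A /= in_itv].
have Kpt e t : E e -> a <= t <= b -> K (pt 2 [:: e; t]).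
  by move=> Ee tab i; rewrite mxE /A; case: i => -[|[|//]] ilt.
have Kc : compact K.
  apply: rV_compact => i; rewrite /A; case: ifP => _; exact: segment_compact.
have ptE (v : 'rV[R]_2) : pt 2 [:: v 0 0; v 0 i1] = v.
  apply/rowP; case=> -[|[|//]] ilt; rewrite mxE /=; congr (v _ _); exact: val_inj.
have [||z zK zmin] := @EVT_min_rV R _ (partial_within D i1 G) K _ Kc.
- by exists (pt 2 [:: 0; a]); apply: Kpt; [exact: E0|rewrite lexx].
- apply: (continuous_subspaceW (B := D)) (d_eps_delta_C1 i1).2.
  by move=> v /KP[].
have {}zK : K z by move: zK; rewrite inE.
exists (partial_within D i1 G z).
  have [Ez z1] := KP _ zK.
  by rewrite -(ptE z) -d_tau_eps_deltaE//; apply: pos.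
move=> e t Ee tab; rewrite d_tau_eps_deltaE//; apply: zmin.
by rewrite inE; apply: Kpt.
Qed.

(** The increment over [[T, T + u]] has modulus at least [|e| c u], which a zero derivative forbids
    at tolerance [|e| c / 2]. *)
Lemma delta_slope_neq0 e T h l : E e -> e != 0 -> 0 < h ->
  (forall e t, E e -> T <= t <= T + h -> 0 < d_tau_eps_delta d e (toS1 t)) ->
  slope_cvg setT (fun u => delta d e (toS1 (T + u))) 0 l -> l != 0.
Proof.
move=> Ee e0 h0 pos; have Th : T <= T + h by rewrite lerDl ltW.
have [c c0 cP] := d_tau_eps_delta_lower_bound Th pos.
move=> dl; apply/negP => /eqP l0; move: dl; rewrite l0 => /slope_cvgP H.
have ec0 : 0 < `|e| * c by rewrite mulr_gt0// normr_gt0.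
have [|r r0 rf] := H (`|e| * c / 2); first by rewrite divr_gt0.
(* Below [r] for the derivative estimate, at most [h] for the lower bound. *)
pose u := Num.min (r / 2) h.
have u0 : 0 < u by rewrite lt_min divr_gt0.
have ur : u < r by rewrite gt_min; apply/orP; left; lra.
have uh : u <= h by rewrite ge_min lexx orbT.
have [xi [eta [Exi]]] := delta_mixed_mvt T (T + u) Ee.
rewrite /between min_l ?max_r ?lerDl ?(ltW u0)// => /andP[e1 e2] dE.
have := rf u I; rewrite subr0 addr0 mul0r subr0 dE (gtr0_norm u0) => /(_ ur).
have ceta : c <= d_tau_eps_delta d xi (toS1 eta).
  by apply: cP => //; rewrite e1 (le_trans e2)// lerD2l.
rewrite addrAC subrr add0r !normrM (gtr0_norm u0) (gtr0_norm (lt_le_trans c0 ceta)).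
have : `|e| * u * c <= `|e| * u * d_tau_eps_delta d xi (toS1 eta).
  by apply: ler_wpM2l => //; rewrite mulr_ge0// ltW.
have : 0 < `|e| * c * u by rewrite mulr_gt0.
move=> h1 h2 h3; have := le_trans h2 h3; apply/negP; rewrite -ltNge; nra.
Qed.

(** Both points lie on the section with the same parameter and angle, so only [x] can separate
    them. *)
Lemma psec_eq e t : E e -> delta d e t = 0 -> psec d unst e t = psec d stab e t.
Proof.
move=> Ee /eqP; rewrite subr_eq0 => /eqP xE.
have [_ yu _ eu su] := psec_spec S unst t Ee.
have [_ ys _ es ss] := psec_spec S stab t Ee.
by apply: eq_state; rewrite ?yu ?ys ?eu ?es ?su ?ss.
Qed.

Lemma delta_tau_continuous e a b : E e ->
  {within `[a, b], continuous (fun u => delta d e (toS1 u))}.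
Proof.
move=> Ee; apply/subspace_continuousP => x xab.
have H := @angle_slope F e x (Ck_C1 (delta_C2 S)) Ee.
apply: (@slope_cvg_within _ _ (fun u => delta d e (toS1 u)) x
  (partial_within D i1 F (pt 2 [:: e; x]))).
apply: eq_slope_cvg (@slope_cvg_sub _ setT _ _ _ _ (fun _ _ => I) H) => //.
by move=> u _; rewrite /F !mxE.
Qed.

Lemma psec_transversal e t h : E e -> e != 0 -> 0 < h ->
  (forall e t', E e -> t <= t' <= t + h -> 0 < d_tau_eps_delta d e (toS1 t')) ->
  psec d unst e (toS1 t) = psec d stab e (toS1 t) ->
  transversal_at d e (psec d unst e (toS1 t)).
Proof.
move=> Ee e0 h0 pos pE.
have [pu [du tu]] := psec_slope S unst t Ee.
have [ps [ds ts]] := psec_slope S stab t Ee.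
have [_ _ + _ _] := psec_spec S unst (toS1 t) Ee.
rewrite -pE in ts; move: tu ts.
set q := psec _ _ _ _; move: (field d q).1 (field d q).2 => f1 f2 tu ts f20.
have : pu + (-1) * ps != 0.
  apply: (delta_slope_neq0 Ee e0 h0 pos).
  apply: eq_slope_cvg (slope_cvg_lin (a := -1) du ds) => // u _.
  by rewrite mulN1r.
rewrite mulN1r => l0.
move=> [[v1 v2] v3].
(* The stable vector is taken without field component. Then the [y] equation gives [be], the [s]
   equation gives the stable coefficient [v3 - be - al], and the [x] equation gives [al] on division
   by [pu - ps]. *)
pose be := v2 / f2.
pose al := (v1 - be * f1 - (v3 - be) * ps) / (pu - ps).
have alE : al * (pu - ps) = v1 - be * f1 - (v3 - be) * ps by rewrite /al divfK.
have beE : be * f2 = v2 by rewrite /be divfK.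
eexists; eexists; split; [exact: (tu al be)|exact: (ts (v3 - be - al) 0)|].
transitivity (al * pu + be * f1 + ((v3 - be - al) * ps + 0 * f1),
  be * f2 + 0 * f2, al + be + (v3 - be - al + 0)); last by [].
congr (_, _, _).
- transitivity (al * (pu - ps) + be * f1 + (v3 - be) * ps); last by ring.
  by rewrite alE; ring.
- by rewrite mul0r addr0.
- by ring.
Qed.

End Splitting.

(** * Zeros of the splitting function on the arc *)

Section Zeros.
Variables (R : realType) (d : splitting_data R).
Hypothesis S : splitting_setting d.

Lemma delta_zero e T l : E d e -> e != 0 -> 0 < l ->
  (forall e, E d e -> d_eps_delta d e (toS1 T) < 0) ->
  (forall e, E d e -> 0 < d_eps_delta d e (toS1 (T + l))) ->
  exists2 u, 0 < u < l & delta d e (toS1 (T + u)) = 0.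
Proof.
move=> Ee e0 l0 neg pos.
have [x1 [_ /neg n1 d1]] := delta_eps_mvt S T Ee.
have [x2 [_ /pos p2 d2]] := delta_eps_mvt S (T + l) Ee.
have Tl : T <= T + l by rewrite lerDl ltW.
have dc := @delta_tau_continuous _ _ S e T (T + l) Ee.
(* The sign of [e] decides which end value is negative; the unordered form covers both cases. *)
have mid : Num.min (delta d e (toS1 T)) (delta d e (toS1 (T + l))) <= 0 <=
    Num.max (delta d e (toS1 T)) (delta d e (toS1 (T + l))).
  rewrite ge_min le_max d1 d2.
  move: e0; rewrite neq_lt => /orP[e0|e0]; apply/andP; split; apply/orP;
    [right|left|left|right]; nra.
have [c cTl c0] := IVT Tl dc mid.
have nz t : delta d e (toS1 t) != 0 -> c != t.
  by apply: contraNneq => <-; rewrite c0.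
have /nz cT : delta d e (toS1 T) != 0 by rewrite d1 mulf_neq0// lt_eqF.
have /nz cl : delta d e (toS1 (T + l)) != 0 by rewrite d2 mulf_neq0// gt_eqF.
exists (c - T); last by rewrite addrC subrK.
move: cTl; rewrite in_itv /= !le_eqVlt (negbTE cl) eq_sym (negbTE cT) /= => /andP[c1 c2].
by apply/andP; split; lra.
Qed.
End Zeros.
Theorem theorem9 (R : realType) (d : splitting_data R)
    (setting : splitting_setting d) (tau1 tau2 : S1 R)
    (neg : forall e : R, E d e -> d_eps_delta d e tau1 < 0)
    (pos : forall e : R, E d e -> 0 < d_eps_delta d e tau2) :
  (forall e : R, E d e -> e <> 0 ->
     exists tau : S1 R, open_arc tau1 tau2 tau /\
     exists q : state R,
       [/\ Weps d unst e q, Weps d stab e q, Sigma q, pieps q = e & pis q = tau])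
  /\
  ((forall (e : R) (tau : S1 R), E d e -> open_arc tau1 tau2 tau ->
      0 < d_tau_eps_delta d e tau) ->
   forall e : R, E d e -> e <> 0 ->
     exists tau : S1 R,
       [/\ open_arc tau1 tau2 tau,
           psec d unst e tau = psec d stab e tau,
           (forall tau' : S1 R, open_arc tau1 tau2 tau' ->
              psec d unst e tau' = psec d stab e tau' -> tau' = tau) &
           exists q : state R,
             q = psec d unst e tau /\
             [/\ Weps d unst e q, Weps d stab e q, Sigma q,
                 pieps q = e /\ pis q = tau & transversal_at d e q]]).
Proof.
have ne0 (e : R) : e <> 0 -> e != 0 by move/eqP.
(* Otherwise the derivative at [eps = 0] would be both negative and positive there. *)
have tau12 : tau1 != tau2.
  apply/eqP => eq12; have := neg _ (E0 setting); rewrite eq12 => n.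
  by have := lt_trans n (pos _ (E0 setting)); rewrite ltxx.
have [l lpi tau2E] := arc_length tau12.
have /andP[l0 _] := lpi.
pose T := repr tau1.
have tau1E : tau1 = toS1 T by rewrite toS1_repr.
have arcP tau : open_arc tau1 tau2 tau <->
    exists2 u, 0 < u < l & tau = toS1 (T + u).
  rewrite tau2E open_arcP// tau1E.
  by split=> -[u ul uE]; exists u; rewrite ?toS1D// -toS1D.
have zero e : E d e -> e <> 0 -> exists2 u, 0 < u < l & delta d e (toS1 (T + u)) = 0.
  move=> Ee /ne0 e0; apply: delta_zero => //.
    by move=> e' /neg; rewrite tau1E.
  by move=> e' /pos; rewrite tau2E tau1E toS1D.
split=> [e Ee e0|mono e Ee e0]; have [u ul du] := zero e Ee e0.
  exists (toS1 (T + u)); split; first by apply/arcP; exists u.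
  have pE := psec_eq setting Ee du.
  have [Wu yq _ eq sq] := psec_spec setting unst (toS1 (T + u)) Ee.
  have [Ws _ _ _ _] := psec_spec setting stab (toS1 (T + u)) Ee.
  by rewrite -pE in Ws; exists (psec d unst e (toS1 (T + u))).
have pE := psec_eq setting Ee du.
have mono' e' t : E d e' -> T < t < T + l -> 0 < d_tau_eps_delta d e' (toS1 t).
  move=> Ee' /andP[t1 t2]; apply: mono => //; apply/arcP; exists (t - T).
    by apply/andP; split; lra.
  by rewrite addrC subrK.
exists (toS1 (T + u)); split=> //.
- by apply/arcP; exists u.
- move=> _ /arcP[u' ul' ->] pE'.
  (* Two zeros make [e (u' - u)] times a positive mixed derivative vanish; [eta] lies between two
     points of the arc, hence in it. *)
  have [xi [eta [Exi ub]]] := delta_mixed_mvt setting (T + u) (T + u') Ee.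
  rewrite du /delta pE' !subrr => /esym/eqP.
  have eta_in : T < eta < T + l.
    move: ub ul ul'; rewrite /between ge_min le_max.
    move=> /andP[/orP[]h1 /orP[]h2] /andP[u1 u2] /andP[u3 u4]; apply/andP; split; lra.
  rewrite !mulf_eq0 (gt_eqF (mono' _ _ Exi eta_in)) (negbTE (ne0 _ e0)) orbF /=.
  by rewrite subr_eq0 => /eqP ->.
- have [Wu yq _ eq sq] := psec_spec setting unst (toS1 (T + u)) Ee.
  have [Ws _ _ _ _] := psec_spec setting stab (toS1 (T + u)) Ee.
  rewrite -pE in Ws; exists (psec d unst e (toS1 (T + u))); split=> //; split=> //.
  have /andP[u1 u2] := ul.
  (* Half the remaining length keeps the closed interval [[T + u, T + u + h]] inside the open
     arc. *)
  apply: (psec_transversal setting (h := (l - u) / 2)) => //; first exact: ne0.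
    by lra.
  by move=> e' t Ee' /andP[t1 t2]; apply: mono' => //; apply/andP; split; lra.
Qed.
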